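(* Let $L\colon \mathsf{Set}\to\mathsf{Petri}$ be the functor sending a set $X$ to the Petri net with set of places $X$ and no transitions. There is a symmetric monoidal double category $\mathbb{O}\mathbf{pen}(\mathsf{Petri})$ for which: (1) objects are sets, and vertical 1-morphisms are functions, with the usual composition of functions; (2) horizontal 1-cells from a set $X$ to a set $Y$ are open Petri nets, i.e. diagrams $LX \xrightarrow{i} P \xleftarrow{o} LY$ in $\mathsf{Petri}$; (3) 2-morphisms from $LX \xrightarrow{i} P \xleftarrow{o} LY$ to $LX' \xrightarrow{i'} P' \xleftarrow{o'} LY'$ are triples $(f\colon X\to X',\ \alpha\colon P\to P',\ g\colon Y\to Y')$, with $f,g$ functions (the vertical source and target) and $\alpha$ a morphism in $\mathsf{Petri}$, such that $\alpha\, i = i'\, L f$ and $\alpha\, o = o'\, L g$; (4) the composite of horizontal 1-cells $LX \xrightarrow{i_1} P \xleftarrow{o_1} LY$ and $LY \xrightarrow{i_2} Q \xleftarrow{o_2} LZ$ is $LX \xrightarrow{j_P i_1} P+_{LY}Q \xleftarrow{j_Q o_2} LZ$, where $P \xrightarrow{j_P} P+_{LY}Q \xleftarrow{j_Q} Q$ is a (chosen) pushout of $P \xleftarrow{o_1} LY \xrightarrow{i_2} Q$; (5) the horizontal composite of 2-morphisms $(f,\alpha,g)$ from $LX \xrightarrow{i_1} P \xleftarrow{o_1} LY$ to $LX' \xrightarrow{i_1'} P' \xleftarrow{o_1'} LY'$ and $(g,\beta,h)$ from $LY \xrightarrow{i_2} Q \xleftarrow{o_2} LZ$ to $LY' \xrightarrow{i_2'}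 Q' \xleftarrow{o_2'} LZ'$ is $(f,\ \alpha+_{Lg}\beta,\ h)$, where $\alpha+_{Lg}\beta\colon P+_{LY}Q\to P'+_{LY'}Q'$ is the map induced on pushouts by $\alpha$, $Lg$, $\beta$; (6) vertical composition of 2-morphisms is componentwise composition: $(f',\alpha',g')(f,\alpha,g)=(f'f,\alpha'\alpha,g'g)$; (7) the symmetric monoidal structure comes from (chosen) coproducts in $\mathsf{Set}$ and $\mathsf{Petri}$: the tensor product of objects and of vertical 1-morphisms is their coproduct; the tensor product of $LX_1 \xrightarrow{i_1} P_1 \xleftarrow{o_1} LY_1$ and $LX_2 \xrightarrow{i_2} P_2 \xleftarrow{o_2} LY_2$ is $L(X_1+X_2) \xrightarrow{i_1+i_2} P_1+P_2 \xleftarrow{o_1+o_2} L(Y_1+Y_2)$ (using the canonical isomorphisms $L(X_1+X_2)\cong LX_1+LX_2$ and $L(Y_1+Y_2)\cong LY_1+LY_2$); the tensor product of 2-morphisms $(f_1,\alpha_1,g_1)$ and $(f_2,\alpha_2,g_2)$ is $(f_1+f_2,\alpha_1+\alpha_2,g_1+g_2)$; the units are initial objects, and the symmetry is given by the canonical isomorphisms $a+b\cong b+a$.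
   Context: **Petri nets.** For a set $S$, $\mathbb{N}[S]$ is (the underlying set of) the free commutative monoid on $S$; for a function $g\colon S\to S'$, $\mathbb{N}[g]\colon \mathbb{N}[S]\to\mathbb{N}[S']$ is the unique monoid homomorphism extending $g$. A Petri net is a pair of functions $s,t\colon T\to \mathbb{N}[S]$ with $T$ a set (of transitions) and $S$ a set (of places). A morphism from $(s,t\colon T\to\mathbb{N}[S])$ to $(s',t'\colon T'\to\mathbb{N}[S'])$ is a pair of functions $(f\colon T\to T',\ g\colon S\to S')$ with $s' f=\mathbb{N}[g]s$ and $t' f=\mathbb{N}[g]t$. These form a category $\mathsf{Petri}$ with componentwise composition. The functor $L\colon \mathsf{Set}\to\mathsf{Petri}$ sends $X$ to the Petri net $\emptyset\rightrightarrows \mathbb{N}[X]$ and a function $f$ to the morphism with place component $f$. **Double categories.** A double category $\mathbb{D}$ consists of categories $\mathbb{D}_0$ and $\mathbb{D}_1$, functors $S,T\colon \mathbb{D}_1\to\mathbb{D}_0$, $U\colon\mathbb{D}_0\to\mathbb{D}_1$ and $\odot\colon \mathbb{D}_1\times_{\mathbb{D}_0}\mathbb{D}_1\to\mathbb{D}_1$ (pullback over $\mathbb{D}_1\xrightarrow{T}\mathbb{D}_0\xleftarrow{S}\mathbb{D}_1$) with $S(U_A)=A=T(U_A)$, $S(M\odot N)=SN$, $T(M\odot N)=TM$, and natural isomorphisms $(N\odot N')\odot N''\cong N\odot(N'\odot N'')$, $U_{T(N)}\odot N\cong N$, $N\odot U_{S(N)}\cong N$, whose images under $S$ and $T$ are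 identities and which satisfy the pentagon and triangle identities. Objects and morphisms of $\mathbb{D}_0$ are called objects and vertical 1-morphisms; objects $M$ of $\mathbb{D}_1$ are called horizontal 1-cells from $SM$ to $TM$; morphisms of $\mathbb{D}_1$ are called 2-morphisms. Vertical composition of 2-morphisms is composition in $\mathbb{D}_1$; horizontal composition is $\odot$. A 2-morphism $\alpha$ is globular if $S\alpha$ and $T\alpha$ are identities. A double functor $F\colon\mathbb{A}\to\mathbb{B}$ consists of functors $F_0\colon\mathbb{A}_0\to\mathbb{B}_0$, $F_1\colon\mathbb{A}_1\to\mathbb{B}_1$ with $SF_1=F_0S$, $TF_1=F_0T$, and natural isomorphisms with globular components $F_1(N)\odot F_1(N')\to F_1(N\odot N')$ (composition comparison) and $U_{F_0(A)}\to F_1(U_A)$ (identity comparison), compatible with the associators and left and right unitors in the usual sense. A transformation $F\Rightarrow G$ between double functors consists of natural transformations $\beta_0\colon F_0\Rightarrow G_0$, $\beta_1\colon F_1\Rightarrow G_1$ with $S((\beta_1)_M)=(\beta_0)_{SM}$, $T((\beta_1)_M)=(\beta_0)_{TM}$, commuting with the composition and identity comparisons. A symmetric monoidal double category is a double category $\mathbb{D}$ with double functors $\otimes\colon\mathbb{D}\times\mathbb{D}\to\mathbb{D}$ and $I\colon *\to\mathbb{D}$ ($*$ the terminal double category), invertible transformations giving associativity and left and right unit constraints for $\otimes$ satisfying the pentagon and triangle axioms, and an invertible self-inverse transformation (braiding) $\otimes\Rightarrow\otimes\circ\tau$, with $\tau$ the twist, satisfying the hexagon identities. In particular $\mathbb{D}_0$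 and $\mathbb{D}_1$ are symmetric monoidal categories, $S$ and $T$ are strict symmetric monoidal functors, and the unit of $\mathbb{D}_1$ is $U_I$. *)

(* Defs.v *)
From mathcomp Require Import all_boot finmap multiset boolp.

Set Implicit Arguments.
Unset Strict Implicit.
Unset Printing Implicit Defensive.

Declare Scope cat_scope.
Delimit Scope cat_scope with cat.
Local Open Scope cat_scope.

Record category := Category {
  ob :> Type;
  hom : ob -> ob -> Type;
  idm : forall A, hom A A;
  compose : forall A B C, hom B C -> hom A B -> hom A C;
  compose1m : forall A B (f : hom A B), compose (idm B) f = f;
  composem1 : forall A B (f : hom A B), compose f (idm A) = f;
  composeA : forall A B C D (h : hom C D) (g : hom B C) (f : hom A B),
    compose h (compose g f) = compose (compose h g) f }.

Arguments hom {c} A B.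
Arguments idm {c} A : simpl never.
Arguments compose {c A B C} g f : simpl never.

Notation "g ∘ f" := (compose g f) (at level 40, left associativity) : cat_scope.

Definition inverse_of (C : category) (A B : C) (f : hom A B) (g : hom B A) : Prop :=
  g ∘ f = idm A /\ f ∘ g = idm B.

Definition invertible (C : category) (A B : C) (f : hom A B) : Prop :=
  exists g, inverse_of f g.

Record initial (C : category) (I : C) := Initial {
  init_map : forall X, hom I X;
  init_uniq : forall X (f : hom I X), f = init_map X }.

Record coproduct (C : category) (A B : C) := Coproduct {
  cp_ob :> C;
  cp_inl : hom A cp_ob;
  cp_inr : hom B cp_ob;
  copair : forall X, hom A X -> hom B X -> hom cp_ob X;
  copair_inl : forall X (f : hom A X) (g : hom B X), copair f g ∘ cp_inl = f;
  copair_inr : forall X (f : hom A X) (g : hom B X), copair f g ∘ cp_inr = g;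
  copair_uniq : forall X (f : hom A X) (g : hom B X) (h : hom cp_ob X),
    h ∘ cp_inl = f -> h ∘ cp_inr = g -> h = copair f g }.

Record pushout (C : category) (Y P Q : C) (o : hom Y P) (i : hom Y Q) := Pushout {
  po_ob :> C;
  po_inl : hom P po_ob;
  po_inr : hom Q po_ob;
  po_square : po_inl ∘ o = po_inr ∘ i;
  po_map : forall X (f : hom P X) (g : hom Q X), f ∘ o = g ∘ i -> hom po_ob X;
  po_map_inl : forall X (f : hom P X) (g : hom Q X) (e : f ∘ o = g ∘ i),
    po_map e ∘ po_inl = f;
  po_map_inr : forall X (f : hom P X) (g : hom Q X) (e : f ∘ o = g ∘ i),
    po_map e ∘ po_inr = g;
  po_map_uniq : forall X (f : hom P X) (g : hom Q X) (e : f ∘ o = g ∘ i)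
      (h : hom po_ob X),
    h ∘ po_inl = f -> h ∘ po_inr = g -> h = po_map e }.

Definition coproducts (C : category) := forall A B : C, coproduct A B.

Section CanonicalMaps.
Variables (C : category) (cp : coproducts C).

Definition cp_map (A B A' B' : C) (f : hom A A') (g : hom B B') :
    hom (cp A B) (cp A' B') :=
  copair (cp A B) (cp_inl (cp A' B') ∘ f) (cp_inr (cp A' B') ∘ g).

Definition cp_assoc (A B D : C) : hom (cp (cp A B) D) (cp A (cp B D)) :=
  copair (cp (cp A B) D)
    (copair (cp A B) (cp_inl (cp A (cp B D)))
                     (cp_inr (cp A (cp B D)) ∘ cp_inl (cp B D)))
    (cp_inr (cp A (cp B D)) ∘ cp_inr (cp B D)).

Definition cp_lunit (I : C) (hI : initial I) (A : C) : hom (cp I A) A :=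
  copair (cp I A) (init_map hI A) (idm A).

Definition cp_runit (I : C) (hI : initial I) (A : C) : hom (cp A I) A :=
  copair (cp A I) (idm A) (init_map hI A).

Definition cp_swap (A B : C) : hom (cp A B) (cp B A) :=
  copair (cp A B) (cp_inr (cp B A)) (cp_inl (cp B A)).

End CanonicalMaps.

(* Pentagon, triangle, symmetry and the two hexagons for a tensor product [tens]
   with unit [I], associator [a], unitors [l], [r] and braiding [s].  The second
   hexagon involves the inverse [v] of an associator. *)
Record sm_coherence (C : category) (tens : C -> C -> C)
    (tensm : forall A B A' B', hom A A' -> hom B B' -> hom (tens A B) (tens A' B'))
    (I : C)
    (a : forall A B D, hom (tens (tens A B) D) (tens A (tens B D)))
    (l : forall A, hom (tens I A) A)
    (r : forall A, hom (tens A I) A)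
    (s : forall A B, hom (tens A B) (tens B A)) : Prop := SmCoherence {
  sm_pentagon : forall A B D E,
    a A B (tens D E) ∘ a (tens A B) D E
    = tensm _ _ _ _ (idm A) (a B D E) ∘ a A (tens B D) E
      ∘ tensm _ _ _ _ (a A B D) (idm E);
  sm_triangle : forall A B,
    tensm _ _ _ _ (idm A) (l B) ∘ a A I B = tensm _ _ _ _ (r A) (idm B);
  sm_symmetry : forall A B, s B A ∘ s A B = idm (tens A B);
  sm_hexagon1 : forall A B D,
    a B D A ∘ s A (tens B D) ∘ a A B D
    = tensm _ _ _ _ (idm B) (s A D) ∘ a B A D ∘ tensm _ _ _ _ (s A B) (idm D);
  sm_hexagon2 : forall A B D v, inverse_of (a A D B) v ->
    s (tens A B) D
    = a D A B ∘ tensm _ _ _ _ (s A D) (idm B) ∘ v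
      ∘ tensm _ _ _ _ (idm A) (s B D) ∘ a A B D }.

(* The category D_1 is fibred over D_0 x D_0 at the level of objects: [hor A B]
   is the type of horizontal 1-cells with source [A] and target [B], so that the
   object parts of the equations S(U_A) = A = T(U_A), S(M ⊙ N) = S N and
   T(M ⊙ N) = T M hold by typing.  On 2-morphisms S and T are the maps [csrc] and
   [ctgt], and all equations are stated between morphisms of D_0.  A morphism of
   the pullback D_1 x_{D_0} D_1 is a pair of 2-morphisms [beta], [alpha] together
   with a proof of [csrc beta = ctgt alpha]. *)
Record dbl_base := DblBase {
  dbl0 :> category;
  hor : dbl0 -> dbl0 -> Type;
  cell : forall A B A' B', hor A B -> hor A' B' -> Type;
  csrc : forall A B A' B' (M : hor A B) (M' : hor A' B'), cell M M' -> hom A A';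
  ctgt : forall A B A' B' (M : hor A B) (M' : hor A' B'), cell M M' -> hom B B';
  cid : forall A B (M : hor A B), cell M M;
  ccomp : forall A B A' B' A'' B''
      (M : hor A B) (M' : hor A' B') (M'' : hor A'' B''),
    cell M' M'' -> cell M M' -> cell M M'';
  hcomp : forall A B C, hor B C -> hor A B -> hor A C;
  chcomp : forall A B C A' B' C'
      (M : hor B C) (N : hor A B) (M' : hor B' C') (N' : hor A' B')
      (beta : cell M M') (alpha : cell N N'),
    csrc beta = ctgt alpha -> cell (hcomp M N) (hcomp M' N') }.

Arguments hor {d} A B.
Arguments cell {d A B A' B'} M M'.
Arguments csrc {d A B A' B' M M'} alpha : rename.
Arguments ctgt {d A B A' B' M M'} alpha : rename.
Arguments cid {d A B} M.
Arguments ccomp {d A B A' B' A'' B'' M M' M''} beta alpha : rename.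
Arguments hcomp {d A B C} M N.
Arguments chcomp {d A B C A' B' C' M N M' N'} beta alpha e : rename.

Notation "beta • alpha" := (ccomp beta alpha)
  (at level 40, left associativity) : cat_scope.
Notation "M ⊙ N" := (hcomp M N) (at level 39, left associativity) : cat_scope.

Definition cinvertible (D : dbl_base) (A B A' B' : D) (M : hor A B)
    (M' : hor A' B') (alpha : cell M M') : Prop :=
  exists beta : cell M' M, beta • alpha = cid M /\ alpha • beta = cid M'.

Definition globular (D : dbl_base) (A B : D) (M M' : hor A B)
    (alpha : cell M M') : Prop :=
  csrc alpha = idm A /\ ctgt alpha = idm B.

(* Wherever a composability proof [e] is universally quantified in a law below,
   the equation that it proves follows from the other laws. *)
Record dbl_cat := DblCat {
  dbl_base_of :> dbl_base;
  ccomp1c : forall (A B A' B' : dbl_base_of) (M : hor A B) (M' : hor A' B')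
    (alpha : cell M M'), cid M' • alpha = alpha;
  ccompc1 : forall (A B A' B' : dbl_base_of) (M : hor A B) (M' : hor A' B')
    (alpha : cell M M'), alpha • cid M = alpha;
  ccompA : forall (A B A' B' A'' B'' A3 B3 : dbl_base_of) (M : hor A B)
    (M' : hor A' B') (M'' : hor A'' B'') (M3 : hor A3 B3)
    (gamma : cell M'' M3) (beta : cell M' M'') (alpha : cell M M'),
    gamma • (beta • alpha) = gamma • beta • alpha;
  csrc1 : forall (A B : dbl_base_of) (M : hor A B), csrc (cid M) = idm A;
  ctgt1 : forall (A B : dbl_base_of) (M : hor A B), ctgt (cid M) = idm B;
  csrcM : forall (A B A' B' A'' B'' : dbl_base_of) (M : hor A B)
    (M' : hor A' B') (M'' : hor A'' B'') (beta : cell M' M'') (alpha : cell M M'),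
    csrc (beta • alpha) = csrc beta ∘ csrc alpha;
  ctgtM : forall (A B A' B' A'' B'' : dbl_base_of) (M : hor A B)
    (M' : hor A' B') (M'' : hor A'' B'') (beta : cell M' M'') (alpha : cell M M'),
    ctgt (beta • alpha) = ctgt beta ∘ ctgt alpha;
  hunit : forall A : dbl_base_of, hor A A;
  cunit : forall (A A' : dbl_base_of), hom A A' -> cell (hunit A) (hunit A');
  csrc_unit : forall (A A' : dbl_base_of) (f : hom A A'), csrc (cunit f) = f;
  ctgt_unit : forall (A A' : dbl_base_of) (f : hom A A'), ctgt (cunit f) = f;
  cunit1 : forall A : dbl_base_of, cunit (idm A) = cid (hunit A);
  cunitM : forall (A B C : dbl_base_of) (g : hom B C) (f : hom A B),
    cunit (g ∘ f) = cunit g • cunit f;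
  csrc_hcomp : forall (A B C A' B' C' : dbl_base_of) (M : hor B C) (N : hor A B)
    (M' : hor B' C') (N' : hor A' B') (beta : cell M M') (alpha : cell N N')
    (e : csrc beta = ctgt alpha), csrc (chcomp beta alpha e) = csrc alpha;
  ctgt_hcomp : forall (A B C A' B' C' : dbl_base_of) (M : hor B C) (N : hor A B)
    (M' : hor B' C') (N' : hor A' B') (beta : cell M M') (alpha : cell N N')
    (e : csrc beta = ctgt alpha), ctgt (chcomp beta alpha e) = ctgt beta;
  chcomp1 : forall (A B C : dbl_base_of) (M : hor B C) (N : hor A B) e,
    chcomp (cid M) (cid N) e = cid (M ⊙ N);
  chcompM : forall (A B C A' B' C' A'' B'' C'' : dbl_base_of)
    (M : hor B C) (N : hor A B) (M' : hor B' C') (N' : hor A' B')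
    (M'' : hor B'' C'') (N'' : hor A'' B'')
    (beta' : cell M' M'') (alpha' : cell N' N'')
    (beta : cell M M') (alpha : cell N N') e' e e'',
    chcomp (beta' • beta) (alpha' • alpha) e''
    = chcomp beta' alpha' e' • chcomp beta alpha e;
  hassoc : forall (A B C D : dbl_base_of) (M : hor C D) (N : hor B C)
    (P : hor A B), cell (M ⊙ N ⊙ P) (M ⊙ (N ⊙ P));
  hassoc_inv : forall (A B C D : dbl_base_of) (M : hor C D) (N : hor B C)
    (P : hor A B), cinvertible (hassoc M N P);
  hassoc_glob : forall (A B C D : dbl_base_of) (M : hor C D) (N : hor B C)
    (P : hor A B), globular (hassoc M N P);
  hassoc_nat : forall (A B C D A' B' C' D' : dbl_base_of)
    (M : hor C D) (N : hor B C) (P : hor A B)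
    (M' : hor C' D') (N' : hor B' C') (P' : hor A' B')
    (gamma : cell M M') (beta : cell N N') (alpha : cell P P') e1 e2 e3 e4,
    hassoc M' N' P' • chcomp (chcomp gamma beta e1) alpha e2
    = chcomp gamma (chcomp beta alpha e3) e4 • hassoc M N P;
  hlunit : forall (A B : dbl_base_of) (N : hor A B), cell (hunit B ⊙ N) N;
  hlunit_inv : forall (A B : dbl_base_of) (N : hor A B), cinvertible (hlunit N);
  hlunit_glob : forall (A B : dbl_base_of) (N : hor A B), globular (hlunit N);
  hlunit_nat : forall (A B A' B' : dbl_base_of) (N : hor A B) (N' : hor A' B')
    (alpha : cell N N') e,
    hlunit N' • chcomp (cunit (ctgt alpha)) alpha e = alpha • hlunit N;
  hrunit : forall (A B : dbl_base_of) (N : hor A B), cell (N ⊙ hunit A) N;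
  hrunit_inv : forall (A B : dbl_base_of) (N : hor A B), cinvertible (hrunit N);
  hrunit_glob : forall (A B : dbl_base_of) (N : hor A B), globular (hrunit N);
  hrunit_nat : forall (A B A' B' : dbl_base_of) (N : hor A B) (N' : hor A' B')
    (alpha : cell N N') e,
    hrunit N' • chcomp alpha (cunit (csrc alpha)) e = alpha • hrunit N;
  hpentagon : forall (A B C D E : dbl_base_of) (M : hor D E) (N : hor C D)
    (P : hor B C) (Q : hor A B) e1 e2,
    hassoc M N (P ⊙ Q) • hassoc (M ⊙ N) P Q
    = chcomp (cid M) (hassoc N P Q) e1 • hassoc M (N ⊙ P) Q
      • chcomp (hassoc M N P) (cid Q) e2;
  htriangle : forall (A B C : dbl_base_of) (M : hor B C) (N : hor A B) e1 e2,
    chcomp (cid M) (hlunit N) e1 • hassoc M (hunit B) N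
    = chcomp (hrunit M) (cid N) e2 }.

Arguments hunit {d} A.
Arguments cunit {d A A'} f.
Arguments hassoc {d A B C D} M N P.
Arguments hlunit {d A B} N.
Arguments hrunit {d A B} N.
Arguments chcompM {d A B C A' B' C' A'' B'' C'' M N M' N' M'' N''
  beta' alpha' beta alpha} e' e e'' : rename.

(* D_1, its objects bundled with their source and target *)
Section TotalCategory.
Variable D : dbl_cat.

Definition dbl1_ob := {AB : D * D & hor AB.1 AB.2}.

Definition hcell (A B : D) (M : hor A B) : dbl1_ob :=
  existT (fun AB : D * D => hor AB.1 AB.2) (A, B) M.

Definition dbl1 : category :=
  @Category dbl1_ob (fun x y => cell (projT2 x) (projT2 y))
    (fun x => cid (projT2 x)) (fun x y z beta alpha => beta • alpha)
    (fun x y => @ccomp1c D _ _ _ _ _ _) (fun x y => @ccompc1 D _ _ _ _ _ _)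
    (fun x y z t => @ccompA D _ _ _ _ _ _ _ _ _ _ _ _).

End TotalCategory.

Record dbl_functor (A B : dbl_cat) := DblFunctor {
  f0 :> A -> B;
  f0m : forall X Y, hom X Y -> hom (f0 X) (f0 Y);
  f0m1 : forall X, f0m (idm X) = idm (f0 X);
  f0mM : forall X Y Z (g : hom Y Z) (f : hom X Y), f0m (g ∘ f) = f0m g ∘ f0m f;
  f1 : forall X Y, hor X Y -> hor (f0 X) (f0 Y);
  f1m : forall X Y X' Y' (M : hor X Y) (M' : hor X' Y'),
    cell M M' -> cell (f1 M) (f1 M');
  f1m1 : forall X Y (M : hor X Y), f1m (cid M) = cid (f1 M);
  f1mM : forall X Y X' Y' X'' Y'' (M : hor X Y) (M' : hor X' Y')
    (M'' : hor X'' Y'') (beta : cell M' M'') (alpha : cell M M'),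
    f1m (beta • alpha) = f1m beta • f1m alpha;
  f1m_src : forall X Y X' Y' (M : hor X Y) (M' : hor X' Y') (alpha : cell M M'),
    csrc (f1m alpha) = f0m (csrc alpha);
  f1m_tgt : forall X Y X' Y' (M : hor X Y) (M' : hor X' Y') (alpha : cell M M'),
    ctgt (f1m alpha) = f0m (ctgt alpha);
  fcomp : forall X Y Z (M : hor Y Z) (N : hor X Y), cell (f1 M ⊙ f1 N) (f1 (M ⊙ N));
  fcomp_inv : forall X Y Z (M : hor Y Z) (N : hor X Y), cinvertible (fcomp M N);
  fcomp_glob : forall X Y Z (M : hor Y Z) (N : hor X Y), globular (fcomp M N);
  fcomp_nat : forall X Y Z X' Y' Z' (M : hor Y Z) (N : hor X Y)
    (M' : hor Y' Z') (N' : hor X' Y') (beta : cell M M') (alpha : cell N N') e e',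
    fcomp M' N' • chcomp (f1m beta) (f1m alpha) e'
    = f1m (chcomp beta alpha e) • fcomp M N;
  funit : forall X, cell (hunit (f0 X)) (f1 (hunit X));
  funit_inv : forall X, cinvertible (funit X);
  funit_glob : forall X, globular (funit X);
  funit_nat : forall X Y (f : hom X Y),
    funit Y • cunit (f0m f) = f1m (cunit f) • funit X;
  f_assoc : forall X Y Z W (M : hor Z W) (N : hor Y Z) (P : hor X Y) e1 e2,
    f1m (hassoc M N P) • fcomp (M ⊙ N) P • chcomp (fcomp M N) (cid (f1 P)) e1
    = fcomp M (N ⊙ P) • chcomp (cid (f1 M)) (fcomp N P) e2
      • hassoc (f1 M) (f1 N) (f1 P);
  f_lunit : forall X Y (N : hor X Y) e,
    f1m (hlunit N) • fcomp (hunit Y) N • chcomp (funit Y) (cid (f1 N)) e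
    = hlunit (f1 N);
  f_runit : forall X Y (N : hor X Y) e,
    f1m (hrunit N) • fcomp N (hunit X) • chcomp (cid (f1 N)) (funit X) e
    = hrunit (f1 N) }.

Arguments f0 {A B} F X : rename.
Arguments f0m {A B} F {X Y} f : rename.
Arguments f1 {A B} F {X Y} M : rename.
Arguments f1m {A B} F {X Y X' Y' M M'} alpha : rename.
Arguments fcomp {A B} F {X Y Z} M N : rename.
Arguments funit {A B} F X : rename.
Arguments fcomp_nat {A B} F {X Y Z X' Y' Z' M N M' N' beta alpha} e e' : rename.
Arguments f_assoc {A B} F {X Y Z W M N P} e1 e2 : rename.
Arguments f_lunit {A B} F {X Y N} e : rename.
Arguments f_runit {A B} F {X Y N} e : rename.

Record dbl_transf (A B : dbl_cat) (F G : dbl_functor A B) := DblTransf {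
  t0 : forall X, hom (f0 F X) (f0 G X);
  t0_nat : forall X Y (f : hom X Y), t0 Y ∘ f0m F f = f0m G f ∘ t0 X;
  t1 : forall X Y (M : hor X Y), cell (f1 F M) (f1 G M);
  t1_nat : forall X Y X' Y' (M : hor X Y) (M' : hor X' Y') (alpha : cell M M'),
    t1 M' • f1m F alpha = f1m G alpha • t1 M;
  t1_src : forall X Y (M : hor X Y), csrc (t1 M) = t0 X;
  t1_tgt : forall X Y (M : hor X Y), ctgt (t1 M) = t0 Y;
  t_comp : forall X Y Z (M : hor Y Z) (N : hor X Y) e,
    t1 (M ⊙ N) • fcomp F M N = fcomp G M N • chcomp (t1 M) (t1 N) e;
  t_unit : forall X, t1 (hunit X) • funit F X = funit G X • cunit (t0 X) }.

Arguments t0 {A B F G} t X : rename.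
Arguments t1 {A B F G} t {X Y} M : rename.

Definition t_invertible (A B : dbl_cat) (F G : dbl_functor A B)
    (t : dbl_transf F G) : Prop :=
  (forall X, invertible (t0 t X)) /\
  (forall X Y (M : hor X Y), cinvertible (t1 t M)).

Lemma chcomp_congr (D : dbl_base) (A B C A' B' C' : D)
    (M : hor B C) (N : hor A B) (M' : hor B' C') (N' : hor A' B')
    (beta1 beta2 : cell M M') (alpha1 alpha2 : cell N N') e1 e2 :
  beta1 = beta2 -> alpha1 = alpha2 ->
  chcomp beta1 alpha1 e1 = chcomp beta2 alpha2 e2.
Proof.
move=> hb ha; case: beta2 / hb e2; case: alpha2 / ha => e2.
by rewrite (Prop_irrelevance e1 e2).
Qed.

Definition terminal_cat : category :=
  @Category unit (fun _ _ => unit) (fun _ => tt) (fun _ _ _ _ _ => tt)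
    (fun _ _ f => let: tt := f in erefl) (fun _ _ f => let: tt := f in erefl)
    (fun _ _ _ _ _ _ _ => erefl).

Definition terminal_base : dbl_base :=
  @DblBase terminal_cat (fun _ _ => unit) (fun _ _ _ _ _ _ => unit)
    (fun _ _ _ _ _ _ _ => tt) (fun _ _ _ _ _ _ _ => tt) (fun _ _ _ => tt)
    (fun _ _ _ _ _ _ _ _ _ _ _ => tt) (fun _ _ _ _ _ => tt)
    (fun _ _ _ _ _ _ _ _ _ _ _ _ _ => tt).

Definition terminal_dbl : dbl_cat.
Proof.
refine {| dbl_base_of := terminal_base;
  hunit := fun _ => tt; cunit := fun _ _ _ => tt;
  hassoc := fun _ _ _ _ _ _ _ => tt;
  hlunit := fun _ _ _ => tt; hrunit := fun _ _ _ => tt |}.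
all: abstract (rewrite /cinvertible /globular /=; intros;
  repeat match goal with x : unit |- _ => destruct x end; 
  solve [by [] | by exists tt | by split]).
Defined.

Definition prod_cat (C C' : category) : category.
Proof.
refine {| ob := C * C';
  hom := fun A B => (hom A.1 B.1 * hom A.2 B.2)%type;
  idm := fun A => (idm A.1, idm A.2);
  compose := fun A B D g f => (g.1 ∘ f.1, g.2 ∘ f.2) |}.
- abstract (by move=> A B [f g]; rewrite !compose1m).
- abstract (by move=> A B [f g]; rewrite !composem1).
- abstract (by move=> A B D E h g f; rewrite !composeA).
Defined.

Definition prod_base (D E : dbl_base) : dbl_base :=
  @DblBase (prod_cat D E)
    (fun A B => (hor A.1 B.1 * hor A.2 B.2)%type)
    (fun A B A' B' M M' => (cell M.1 M'.1 * cell M.2 M'.2)%type)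
    (fun A B A' B' M M' alpha => (csrc alpha.1, csrc alpha.2))
    (fun A B A' B' M M' alpha => (ctgt alpha.1, ctgt alpha.2))
    (fun A B M => (cid M.1, cid M.2))
    (fun _ _ _ _ _ _ _ _ _ beta alpha =>
       (beta.1 • alpha.1, beta.2 • alpha.2))
    (fun A B C M N => (M.1 ⊙ N.1, M.2 ⊙ N.2))
    (fun _ _ _ _ _ _ _ _ _ _ beta alpha e =>
       (chcomp beta.1 alpha.1 (congr1 fst e), chcomp beta.2 alpha.2 (congr1 snd e))).

Lemma prod_cinvertible (D E : dbl_base) (A B A' B' : prod_base D E)
    (M : hor A B) (M' : hor A' B') (alpha : cell M M') :
  cinvertible (D := D) alpha.1 -> cinvertible (D := E) alpha.2 ->
  cinvertible alpha.
Proof.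
by move=> [b1 [h1 h1']] [b2 [h2 h2']]; exists (b1, b2);
   split; apply: injective_projections.
Qed.

Lemma prod_globular (D E : dbl_base) (A B : prod_base D E)
    (M M' : hor A B) (alpha : cell M M') :
  globular (D := D) alpha.1 -> globular (D := E) alpha.2 -> globular alpha.
Proof.
by move=> [h1 h1'] [h2 h2']; split; apply: injective_projections.
Qed.

Definition prod_dbl (D E : dbl_cat) : dbl_cat.
Proof.
refine {| dbl_base_of := prod_base D E;
  hunit := fun A => (hunit A.1, hunit A.2) : hor (d := prod_base D E) A A;
  cunit := fun A A' f => (cunit f.1, cunit f.2);
  hassoc := fun A B C A' M N P =>
    (hassoc M.1 N.1 P.1, hassoc M.2 N.2 P.2)
    : cell (d := prod_base D E) (M ⊙ N ⊙ P) (M ⊙ (N ⊙ P));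
  hlunit := fun A B N => (hlunit N.1, hlunit N.2);
  hrunit := fun A B N => (hrunit N.1, hrunit N.2) |}.
- abstract (by intros; apply: injective_projections; apply: ccomp1c).
- abstract (by intros; apply: injective_projections; apply: ccompc1).
- abstract (by intros; apply: injective_projections; apply: ccompA).
- abstract (by intros; apply: injective_projections; apply: csrc1).
- abstract (by intros; apply: injective_projections; apply: ctgt1).
- abstract (by intros; apply: injective_projections; apply: csrcM).
- abstract (by intros; apply: injective_projections; apply: ctgtM).
- abstract (by intros; apply: injective_projections; apply: csrc_unit).
- abstract (by intros; apply: injective_projections; apply: ctgt_unit).
- abstract (by intros; apply: injective_projections; apply: cunit1).
- abstract (by intros; apply: injective_projections; apply: cunitM).
- abstract (by intros; apply: injective_projections; apply: csrc_hcomp).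
- abstract (by intros; apply: injective_projections; apply: ctgt_hcomp).
- abstract (by intros; apply: injective_projections; apply: chcomp1).
- abstract (by intros; apply: injective_projections; apply: chcompM).
- abstract (by intros; apply: prod_cinvertible; apply: hassoc_inv).
- abstract (by intros; apply: prod_globular; apply: hassoc_glob).
- abstract (by intros; apply: injective_projections; apply: hassoc_nat).
- abstract (by intros; apply: prod_cinvertible; apply: hlunit_inv).
- abstract (by intros; apply: prod_globular; apply: hlunit_glob).
- abstract (by intros; apply: injective_projections; apply: hlunit_nat).
- abstract (by intros; apply: prod_cinvertible; apply: hrunit_inv).
- abstract (by intros; apply: prod_globular; apply: hrunit_glob).
- abstract (by intros; apply: injective_projections; apply: hrunit_nat).
- abstract (by intros; apply: injective_projections; apply: hpentagon).
- abstract (by intros; apply: injective_projections; apply: htriangle).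
Defined.

Section CellLemmas.
Variable D : dbl_cat.

Lemma cid_inv (A B : D) (M : hor A B) : cinvertible (cid M).
Proof. by exists (cid M); rewrite ccomp1c. Qed.

Lemma cid_glob (A B : D) (M : hor A B) : globular (cid M).
Proof. by split; [apply: csrc1|apply: ctgt1]. Qed.

Lemma ccomp_inv (A B A' B' A'' B'' : D) (M : hor A B) (M' : hor A' B')
    (M'' : hor A'' B'') (beta : cell M' M'') (alpha : cell M M') :
  cinvertible beta -> cinvertible alpha -> cinvertible (beta • alpha).
Proof.
move=> [b [b1 b2]] [a [a1 a2]]; exists (a • b); split.
  by rewrite -ccompA (ccompA b) b1 ccomp1c.
by rewrite -ccompA (ccompA alpha) a2 ccomp1c.
Qed.

Lemma ccomp_glob (A B : D) (M M' M'' : hor A B) (beta : cell M' M'')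
    (alpha : cell M M') :
  globular beta -> globular alpha -> globular (beta • alpha).
Proof.
move=> [b1 b2] [a1 a2]; split.
  by rewrite csrcM b1 a1 compose1m.
by rewrite ctgtM b2 a2 compose1m.
Qed.

End CellLemmas.

Lemma f1m_inv (A B : dbl_cat) (F : dbl_functor A B) (X Y X' Y' : A)
    (M : hor X Y) (M' : hor X' Y') (alpha : cell M M') :
  cinvertible alpha -> cinvertible (f1m F alpha).
Proof.
by move=> [b [b1 b2]]; exists (f1m F b); rewrite -!f1mM b1 b2 !f1m1.
Qed.

Lemma f1m_glob (A B : dbl_cat) (F : dbl_functor A B) (X Y : A)
    (M M' : hor X Y) (alpha : cell M M') :
  globular alpha -> globular (f1m F alpha).
Proof. by move=> [h1 h2]; split; rewrite (f1m_src, f1m_tgt) ?h1 ?h2 f0m1. Qed.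

Lemma f1m_eq (A B : dbl_cat) (F : dbl_functor A B) (X Y Z X' Y' Z' : A)
    (M : hor Y Z) (N : hor X Y) (M' : hor Y' Z') (N' : hor X' Y')
    (beta : cell M M') (alpha : cell N N') :
  csrc beta = ctgt alpha -> csrc (f1m F beta) = ctgt (f1m F alpha).
Proof. by move=> e; rewrite f1m_src f1m_tgt e. Qed.

Definition id_functor (A : dbl_cat) : dbl_functor A A.
Proof.
refine {| f0 := fun X => X; f0m := fun X Y f => f;
  f1 := fun X Y M => M; f1m := fun _ _ _ _ _ _ alpha => alpha;
  fcomp := fun X Y Z M N => cid (M ⊙ N); funit := fun X => cid (hunit X) |}.
- abstract by [].
- abstract by [].
- abstract by [].
- abstract by [].
- abstract by [].
- abstract by [].
- abstract (by intros; apply: cid_inv).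
- abstract (by intros; apply: cid_glob).
- abstract (by intros; rewrite ccomp1c ccompc1; apply: chcomp_congr).
- abstract (by intros; apply: cid_inv).
- abstract (by intros; apply: cid_glob).
- abstract (by intros; rewrite ccomp1c ccompc1).
- abstract (by intros; rewrite !chcomp1 !ccompc1 !ccomp1c).
- abstract (by intros; rewrite chcomp1 !ccompc1).
- abstract (by intros; rewrite chcomp1 !ccompc1).
Defined.

Definition fst_functor (A B : dbl_cat) : dbl_functor (prod_dbl A B) A.
Proof.
refine {| f0 := (fun X => X.1) : prod_dbl A B -> A;
  f0m := fun X Y f => f.1;
  f1 := fun X Y M => M.1; f1m := fun _ _ _ _ _ _ alpha => alpha.1;
  fcomp := fun X Y Z M N => cid (M ⊙ N).1;
  funit := fun X => cid (hunit X).1 |}.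
- abstract by [].
- abstract by [].
- abstract by [].
- abstract by [].
- abstract by [].
- abstract by [].
- abstract (by intros; apply: cid_inv).
- abstract (by intros; apply: cid_glob).
- abstract (by intros; rewrite ccomp1c ccompc1; apply: chcomp_congr).
- abstract (by intros; apply: cid_inv).
- abstract (by intros; apply: cid_glob).
- abstract (by intros; rewrite ccomp1c ccompc1).
- abstract (by intros; rewrite !chcomp1 !ccompc1 !ccomp1c).
- abstract (by intros; rewrite chcomp1 !ccompc1).
- abstract (by intros; rewrite chcomp1 !ccompc1).
Defined.

Definition snd_functor (A B : dbl_cat) : dbl_functor (prod_dbl A B) B.
Proof.
refine {| f0 := (fun X => X.2) : prod_dbl A B -> B;
  f0m := fun X Y f => f.2;
  f1 := fun X Y M => M.2; f1m := fun _ _ _ _ _ _ alpha => alpha.2;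
  fcomp := fun X Y Z M N => cid (M ⊙ N).2;
  funit := fun X => cid (hunit X).2 |}.
- abstract by [].
- abstract by [].
- abstract by [].
- abstract by [].
- abstract by [].
- abstract by [].
- abstract (by intros; apply: cid_inv).
- abstract (by intros; apply: cid_glob).
- abstract (by intros; rewrite ccomp1c ccompc1; apply: chcomp_congr).
- abstract (by intros; apply: cid_inv).
- abstract (by intros; apply: cid_glob).
- abstract (by intros; rewrite ccomp1c ccompc1).
- abstract (by intros; rewrite !chcomp1 !ccompc1 !ccomp1c).
- abstract (by intros; rewrite chcomp1 !ccompc1).
- abstract (by intros; rewrite chcomp1 !ccompc1).
Defined.

Definition bang_functor (A : dbl_cat) : dbl_functor A terminal_dbl.
Proof.
refine {| f0 := (fun _ => tt) : A -> terminal_dbl; f0m := fun X Y f => tt;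
  f1 := fun X Y M => tt; f1m := fun _ _ _ _ _ _ alpha => tt;
  fcomp := fun X Y Z M N => tt; funit := fun X => tt |}.
all: abstract (intros; rewrite /cinvertible /globular /=;
  solve [by [] | by exists tt | by split]).
Defined.

Definition pair_functor (A B C : dbl_cat) (F : dbl_functor A B)
  (G : dbl_functor A C) : dbl_functor A (prod_dbl B C).
Proof.
refine {| f0 := (fun X => (f0 F X, f0 G X)) : A -> prod_dbl B C;
  f0m := fun X Y f => (f0m F f, f0m G f);
  f1 := fun X Y M => (f1 F M, f1 G M);
  f1m := fun _ _ _ _ _ _ alpha => (f1m F alpha, f1m G alpha);
  fcomp := fun X Y Z M N => (fcomp F M N, fcomp G M N);
  funit := fun X => (funit F X, funit G X) |}.
- abstract (by intros; apply: injective_projections; apply: f0m1).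
- abstract (by intros; apply: injective_projections; apply: f0mM).
- abstract (by intros; apply: injective_projections; apply: f1m1).
- abstract (by intros; apply: injective_projections; apply: f1mM).
- abstract (by intros; apply: injective_projections; apply: f1m_src).
- abstract (by intros; apply: injective_projections; apply: f1m_tgt).
- abstract (by intros; apply: prod_cinvertible; apply: fcomp_inv).
- abstract (by intros; apply: prod_globular; apply: fcomp_glob).
- abstract (by intros; apply: injective_projections; apply: fcomp_nat).
- abstract (by intros; apply: prod_cinvertible; apply: funit_inv).
- abstract (by intros; apply: prod_globular; apply: funit_glob).
- abstract (by intros; apply: injective_projections; apply: funit_nat).
- abstract (by intros; apply: injective_projections; apply: f_assoc).
- abstract (by intros; apply: injective_projections; apply: f_lunit).
- abstract (by intros; apply: injective_projections; apply: f_runit).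
Defined.

Section CompFunctor.
Variables (A B C : dbl_cat) (G : dbl_functor B C) (F : dbl_functor A B).

Let fc X Y Z (M : hor Y Z) (N : hor X Y) :
    cell (f1 G (f1 F M) ⊙ f1 G (f1 F N)) (f1 G (f1 F (M ⊙ N))) :=
  f1m G (fcomp F M N) • fcomp G (f1 F M) (f1 F N).
Let fu X : cell (hunit (f0 G (f0 F X))) (f1 G (f1 F (hunit X))) :=
  f1m G (funit F X) • funit G (f0 F X).

Lemma comp_fcomp_nat X Y Z X' Y' Z' (M : hor Y Z) (N : hor X Y)
    (M' : hor Y' Z') (N' : hor X' Y') (beta : cell M M') (alpha : cell N N') e e' :
  fc M' N' • chcomp (f1m G (f1m F beta)) (f1m G (f1m F alpha)) e'
  = f1m G (f1m F (chcomp beta alpha e)) • fc M N.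
Proof.
have e2 : csrc (f1m F beta) = ctgt (f1m F alpha) by apply: f1m_eq.
rewrite /fc -ccompA (fcomp_nat G e2 e') ccompA -f1mM (fcomp_nat F e e2) f1mM.
by rewrite -ccompA.
Qed.

Lemma comp_f_assoc X Y Z W (M : hor Z W) (N : hor Y Z) (P : hor X Y) e1 e2 :
  f1m G (f1m F (hassoc M N P)) • fc (M ⊙ N) P
    • chcomp (fc M N) (cid (f1 G (f1 F P))) e1
  = fc M (N ⊙ P) • chcomp (cid (f1 G (f1 F M))) (fc N P) e2
      • hassoc (f1 G (f1 F M)) (f1 G (f1 F N)) (f1 G (f1 F P)).
Proof.
have ef : csrc (fcomp F M N) = ctgt (cid (f1 F P)).
  by rewrite (proj1 (fcomp_glob F M N)) ctgt1.
have eg : csrc (fcomp G (f1 F M) (f1 F N)) = ctgt (cid (f1 G (f1 F P))).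
  by rewrite (proj1 (fcomp_glob G _ _)) ctgt1.
have ef' : csrc (cid (f1 F M)) = ctgt (fcomp F N P).
  by rewrite (proj2 (fcomp_glob F N P)) csrc1.
have eg' : csrc (cid (f1 G (f1 F M))) = ctgt (fcomp G (f1 F N) (f1 F P)).
  by rewrite (proj2 (fcomp_glob G _ _)) csrc1.
have -> : chcomp (fc M N) (cid (f1 G (f1 F P))) e1
  = chcomp (f1m G (fcomp F M N)) (f1m G (cid (f1 F P))) (f1m_eq G ef)
    • chcomp (fcomp G (f1 F M) (f1 F N)) (cid (f1 G (f1 F P))) eg.
  have e3 : csrc (fc M N)
      = ctgt (f1m G (cid (f1 F P)) • cid (f1 G (f1 F P))).
    by rewrite f1m1 ccomp1c.
  rewrite -(chcompM (f1m_eq G ef) eg e3); apply: chcomp_congr => //.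
  by rewrite f1m1 ccomp1c.
have -> : chcomp (cid (f1 G (f1 F M))) (fc N P) e2
  = chcomp (f1m G (cid (f1 F M))) (f1m G (fcomp F N P)) (f1m_eq G ef')
    • chcomp (cid (f1 G (f1 F M))) (fcomp G (f1 F N) (f1 F P)) eg'.
  have e3 : csrc (f1m G (cid (f1 F M)) • cid (f1 G (f1 F M)))
      = ctgt (fc N P).
    by rewrite f1m1 ccomp1c.
  rewrite -(chcompM (f1m_eq G ef') eg' e3); apply: chcomp_congr => //.
  by rewrite f1m1 ccomp1c.
rewrite /fc !ccompA -f1mM.
rewrite -(ccompA _ (fcomp G (f1 F (M ⊙ N)) (f1 F P))) (fcomp_nat G ef (f1m_eq G ef)).
rewrite -(ccompA _ (fcomp G (f1 F M) (f1 F (N ⊙ P)))) (fcomp_nat G ef' (f1m_eq G ef')).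
rewrite !ccompA -!f1mM (f_assoc F ef ef') f1mM.
rewrite f1mM -(ccompA _ (f1m G (hassoc _ _ _))) -(ccompA _ _ (chcomp _ _ eg)).
by rewrite (f_assoc G eg eg') !ccompA.
Qed.

Lemma comp_f_lunit X Y (N : hor X Y) e :
  f1m G (f1m F (hlunit N)) • fc (hunit Y) N
    • chcomp (fu Y) (cid (f1 G (f1 F N))) e
  = hlunit (f1 G (f1 F N)).
Proof.
have ef : csrc (funit F Y) = ctgt (cid (f1 F N)).
  by rewrite (proj1 (funit_glob F Y)) ctgt1.
have eg : csrc (funit G (f0 F Y)) = ctgt (cid (f1 G (f1 F N))).
  by rewrite (proj1 (funit_glob G _)) ctgt1.
have -> : chcomp (fu Y) (cid (f1 G (f1 F N))) e
  = chcomp (f1m G (funit F Y)) (f1m G (cid (f1 F N))) (f1m_eq G ef)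
    • chcomp (funit G (f0 F Y)) (cid (f1 G (f1 F N))) eg.
  have e3 : csrc (fu Y) = ctgt (f1m G (cid (f1 F N)) • cid (f1 G (f1 F N))).
    by rewrite f1m1 ccomp1c.
  rewrite -(chcompM (f1m_eq G ef) eg e3); apply: chcomp_congr => //.
  by rewrite f1m1 ccomp1c.
rewrite /fc !ccompA -f1mM.
rewrite -(ccompA _ (fcomp G (f1 F (hunit Y)) (f1 F N))) (fcomp_nat G ef (f1m_eq G ef)).
by rewrite !ccompA -!f1mM (f_lunit F ef) (f_lunit G eg).
Qed.

Lemma comp_f_runit X Y (N : hor X Y) e :
  f1m G (f1m F (hrunit N)) • fc N (hunit X)
    • chcomp (cid (f1 G (f1 F N))) (fu X) e
  = hrunit (f1 G (f1 F N)).
Proof.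
have ef : csrc (cid (f1 F N)) = ctgt (funit F X).
  by rewrite (proj2 (funit_glob F X)) csrc1.
have eg : csrc (cid (f1 G (f1 F N))) = ctgt (funit G (f0 F X)).
  by rewrite (proj2 (funit_glob G _)) csrc1.
have -> : chcomp (cid (f1 G (f1 F N))) (fu X) e
  = chcomp (f1m G (cid (f1 F N))) (f1m G (funit F X)) (f1m_eq G ef)
    • chcomp (cid (f1 G (f1 F N))) (funit G (f0 F X)) eg.
  have e3 : csrc (f1m G (cid (f1 F N)) • cid (f1 G (f1 F N))) = ctgt (fu X).
    by rewrite f1m1 ccomp1c.
  rewrite -(chcompM (f1m_eq G ef) eg e3); apply: chcomp_congr => //.
  by rewrite f1m1 ccomp1c.
rewrite /fc !ccompA -f1mM.
rewrite -(ccompA _ (fcomp G (f1 F N) (f1 F (hunit X)))) (fcomp_nat G ef (f1m_eq G ef)).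
by rewrite !ccompA -!f1mM (f_runit F ef) (f_runit G eg).
Qed.

Definition comp_functor : dbl_functor A C.
Proof.
refine {| f0 := fun X => f0 G (f0 F X);
  f0m := fun X Y f => f0m G (f0m F f);
  f1 := fun X Y M => f1 G (f1 F M);
  f1m := fun _ _ _ _ _ _ alpha => f1m G (f1m F alpha);
  fcomp := fun X Y Z M N =>
    f1m G (fcomp F M N) • fcomp G (f1 F M) (f1 F N);
  funit := fun X => f1m G (funit F X) • funit G (f0 F X) |}.
- abstract (by intros; rewrite !f0m1).
- abstract (by intros; rewrite !f0mM).
- abstract (by intros; rewrite !f1m1).
- abstract (by intros; rewrite !f1mM).
- abstract (by intros; rewrite !f1m_src).
- abstract (by intros; rewrite !f1m_tgt).
- abstract (by intros; apply: ccomp_inv; [apply/f1m_inv/fcomp_inv|apply: fcomp_inv]).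
- abstract (by intros; apply: ccomp_glob; [apply/f1m_glob/fcomp_glob|apply: fcomp_glob]).
- exact comp_fcomp_nat.
- abstract (by intros; apply: ccomp_inv; [apply/f1m_inv/funit_inv|apply: funit_inv]).
- abstract (by intros; apply: ccomp_glob; [apply/f1m_glob/funit_glob|apply: funit_glob]).
- abstract (by intros; rewrite -ccompA funit_nat ccompA -f1mM funit_nat f1mM -ccompA).
- exact comp_f_assoc.
- exact comp_f_lunit.
- exact comp_f_runit.
Defined.

End CompFunctor.

Section TensorFunctors.
Variables (D : dbl_cat) (T : dbl_functor (prod_dbl D D) D)
  (I : dbl_functor terminal_dbl D).

Definition tensor3l : dbl_functor (prod_dbl (prod_dbl D D) D) D :=
  comp_functor T
    (pair_functor (comp_functor T (fst_functor _ _)) (snd_functor _ _)).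

Definition tensor3r : dbl_functor (prod_dbl (prod_dbl D D) D) D :=
  comp_functor T
    (pair_functor (comp_functor (fst_functor _ _) (fst_functor _ _))
      (comp_functor T
        (pair_functor (comp_functor (snd_functor _ _) (fst_functor _ _))
                      (snd_functor _ _)))).

Definition tensor_unitl : dbl_functor D D :=
  comp_functor T (pair_functor (comp_functor I (bang_functor D)) (id_functor D)).

Definition tensor_unitr : dbl_functor D D :=
  comp_functor T (pair_functor (id_functor D) (comp_functor I (bang_functor D))).

Definition tensor_twist : dbl_functor (prod_dbl D D) D :=
  comp_functor T (pair_functor (snd_functor D D) (fst_functor D D)).

End TensorFunctors.

Section TensorComponents.
Variables (D : dbl_cat) (T : dbl_functor (prod_dbl D D) D)
  (I : dbl_functor terminal_dbl D).

Definition tens0 (A B : D) : D := f0 T (A, B).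
Definition tens0m (A B A' B' : D) (f : hom A A') (g : hom B B') :
    hom (tens0 A B) (tens0 A' B') :=
  @f0m _ _ T (A, B) (A', B') (f, g).
Definition tens1 (A B A' B' : D) (M : hor A B) (N : hor A' B') :
    hor (tens0 A A') (tens0 B B') :=
  @f1 _ _ T (A, A') (B, B') (M, N).
Definition tens1m (A B A' B' C E C' E' : D) (M : hor A B) (N : hor A' B')
    (M' : hor C E) (N' : hor C' E') (alpha : cell M M') (beta : cell N N') :
    cell (tens1 M N) (tens1 M' N') :=
  @f1m _ _ T (A, A') (B, B') (C, C') (E, E') (M, N) (M', N') (alpha, beta).
Definition unit0 : D := f0 I tt.
Definition unit1 : hor unit0 unit0 := @f1 _ _ I tt tt tt.

Section Associator.
Variable a : dbl_transf (tensor3l T) (tensor3r T).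
Definition assoc0 (A B C : D) :
    hom (tens0 (tens0 A B) C) (tens0 A (tens0 B C)) :=
  t0 a ((A, B), C).
Definition assoc1 (A B C A' B' C' : D) (M : hor A A') (N : hor B B')
    (P : hor C C') :
    cell (tens1 (tens1 M N) P) (tens1 M (tens1 N P)) :=
  @t1 _ _ _ _ a ((A, B), C) ((A', B'), C') ((M, N), P).
End Associator.

Section Unitors.
Variables (l : dbl_transf (tensor_unitl T I) (id_functor D))
  (r : dbl_transf (tensor_unitr T I) (id_functor D)).
Definition lunit0 (A : D) : hom (tens0 unit0 A) A := t0 l A.
Definition lunit1 (A B : D) (M : hor A B) : cell (tens1 unit1 M) M := t1 l M.
Definition runit0 (A : D) : hom (tens0 A unit0) A := t0 r A.
Definition runit1 (A B : D) (M : hor A B) : cell (tens1 M unit1) M := t1 r M.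
End Unitors.

Section Braiding.
Variable s : dbl_transf T (tensor_twist T).
Definition braid0 (A B : D) : hom (tens0 A B) (tens0 B A) := t0 s (A, B).
Definition braid1 (A B A' B' : D) (M : hor A B) (N : hor A' B') :
    cell (tens1 M N) (tens1 N M) :=
  @t1 _ _ _ _ s (A, A') (B, B') (M, N).
End Braiding.

End TensorComponents.

(* The axioms are imposed on both D_0 and D_1; [unitF_hor] says that the monoidal
   unit of D_1 is U_I. *)
Record sym_mon_dbl_cat := SymMonDblCat {
  smdc :> dbl_cat;
  tensorF : dbl_functor (prod_dbl smdc smdc) smdc;
  unitF : dbl_functor terminal_dbl smdc;
  unitF_hor : unit1 unitF = hunit (unit0 unitF);
  assocT : dbl_transf (tensor3l tensorF) (tensor3r tensorF);
  assocT_inv : t_invertible assocT;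
  lunitT : dbl_transf (tensor_unitl tensorF unitF) (id_functor smdc);
  lunitT_inv : t_invertible lunitT;
  runitT : dbl_transf (tensor_unitr tensorF unitF) (id_functor smdc);
  runitT_inv : t_invertible runitT;
  braidT : dbl_transf tensorF (tensor_twist tensorF);
  braidT_inv : t_invertible braidT;
  smdc_coherence0 :
    @sm_coherence smdc (tens0 tensorF) (@tens0m _ tensorF) (unit0 unitF)
      (assoc0 assocT) (lunit0 lunitT) (runit0 runitT) (braid0 braidT);
  smdc_coherence1 :
    @sm_coherence (dbl1 smdc)
      (fun x y => hcell (tens1 tensorF (projT2 x) (projT2 y)))
      (fun x y x' y' alpha beta => tens1m tensorF alpha beta)
      (hcell (unit1 unitF))
      (fun x y z => assoc1 assocT (projT2 x) (projT2 y) (projT2 z))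
      (fun x => lunit1 lunitT (projT2 x))
      (fun x => runit1 runitT (projT2 x))
      (fun x y => braid1 braidT (projT2 x) (projT2 y)) }.

(* [sm_data_of D] retains from [D] everything except the horizontal units U, the
   associator and unitors of ⊙, the comparison 2-morphisms of the double functors
   and the axioms.  It serves to state, by a single equation, that a symmetric
   monoidal double category has prescribed cells, compositions and tensor. *)
Record sm_data := SmData {
  smd_base :> dbl_base;
  smd_tens0 : smd_base -> smd_base -> smd_base;
  smd_tens0m : forall A B A' B' : smd_base, hom A A' -> hom B B' ->
    hom (smd_tens0 A B) (smd_tens0 A' B');
  smd_tens1 : forall A B A' B' : smd_base, hor A B -> hor A' B' ->
    hor (smd_tens0 A A') (smd_tens0 B B');
  smd_tens1m : forall (A B A' B' C E C' E' : smd_base) (M : hor A B)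
    (N : hor A' B') (M' : hor C E) (N' : hor C' E'),
    cell M M' -> cell N N' -> cell (smd_tens1 M N) (smd_tens1 M' N');
  smd_unit0 : smd_base;
  smd_unit1 : hor smd_unit0 smd_unit0;
  smd_assoc0 : forall A B C : smd_base,
    hom (smd_tens0 (smd_tens0 A B) C) (smd_tens0 A (smd_tens0 B C));
  smd_assoc1 : forall (A B C A' B' C' : smd_base) (M : hor A A') (N : hor B B')
    (P : hor C C'),
    cell (smd_tens1 (smd_tens1 M N) P) (smd_tens1 M (smd_tens1 N P));
  smd_lunit0 : forall A : smd_base, hom (smd_tens0 smd_unit0 A) A;
  smd_lunit1 : forall (A B : smd_base) (M : hor A B),
    cell (smd_tens1 smd_unit1 M) M;
  smd_runit0 : forall A : smd_base, hom (smd_tens0 A smd_unit0) A;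
  smd_runit1 : forall (A B : smd_base) (M : hor A B),
    cell (smd_tens1 M smd_unit1) M;
  smd_braid0 : forall A B : smd_base, hom (smd_tens0 A B) (smd_tens0 B A);
  smd_braid1 : forall (A B A' B' : smd_base) (M : hor A B) (N : hor A' B'),
    cell (smd_tens1 M N) (smd_tens1 N M) }.

Definition sm_data_of (D : sym_mon_dbl_cat) : sm_data :=
  @SmData D (tens0 (tensorF D)) (@tens0m _ (tensorF D)) (@tens1 _ (tensorF D))
    (@tens1m _ (tensorF D)) (unit0 (unitF D)) (unit1 (unitF D))
    (assoc0 (assocT D)) (@assoc1 _ _ (assocT D))
    (lunit0 (lunitT D)) (@lunit1 _ _ _ (lunitT D))
    (runit0 (runitT D)) (@runit1 _ _ _ (runitT D))
    (braid0 (braidT D)) (@braid1 _ _ (braidT D)).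

Local Open Scope mset_scope.

(* N[S] as finite multisets in S, with sum [msetD]; [classic S] is [S] with
   classical decidable equality and choice.  [free_cmon_map g] is the
   unique monoid homomorphism extending [g]: see [free_cmon_map0],
   [free_cmon_mapD], [free_cmon_map1] and [free_cmon_map_uniq]. *)
Definition free_cmon (S : Type) : Type := {mset {classic S}}.

Definition free_cmon_map (S S' : Type) (g : S -> S') (m : free_cmon S) :
    free_cmon S' :=
  @seq_mset {classic S'} [seq g x | x <- enum_mset (m : {mset {classic S}})].

Section FreeCmon.
Variables (S S' : Type) (g : S -> S').

Lemma free_cmon_mapE (m : free_cmon S) (y : {classic S'}) :
  (free_cmon_map g m : {mset _}) y
  = count (fun x : {classic S} => (g x : {classic S'}) == y)
          (enum_mset (m : {mset _})).
Proof. by rewrite /free_cmon_map mset_seqE count_map. Qed.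

Lemma free_cmon_map_perm (s : seq {classic S}) :
  free_cmon_map g (@seq_mset {classic S} s)
  = @seq_mset {classic S'} [seq g x | x <- s].
Proof.
apply/(@eq_seq_msetP {classic S'}).
by apply: (@perm_map {classic S} {classic S'}); apply: perm_eq_seq_mset.
Qed.

Lemma free_cmon_map0 :
  free_cmon_map g (@mset0 {classic S}) = @mset0 {classic S'}.
Proof.
by apply/(@msetP {classic S'}) => y; rewrite free_cmon_mapE enum_mset0 mset0E.
Qed.

Lemma free_cmon_map1 (x : S) :
  free_cmon_map g [mset (x : {classic S})] = [mset (g x : {classic S'})].
Proof.
apply/(@msetP {classic S'}) => y.
by rewrite free_cmon_mapE enum_msetn /= msetnE eq_sym; case: eqP.
Qed.

Lemma free_cmon_mapD (m n : free_cmon S) :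
  free_cmon_map g (msetD m n) = msetD (free_cmon_map g m) (free_cmon_map g n).
Proof.
rewrite -(seq_mset_id m) -(seq_mset_id n).
set s := enum_mset _; set t := enum_mset _.
have -> : msetD (seq_mset s) (seq_mset t) = seq_mset (s ++ t).
  by apply/msetP => x; rewrite msetE2 !mset_seqE count_cat.
rewrite !free_cmon_map_perm map_cat.
by apply/(@msetP {classic S'}) => x; rewrite msetE2 !mset_seqE count_cat.
Qed.

Lemma free_cmon_map_uniq (h : free_cmon S -> free_cmon S') :
  h (@mset0 {classic S}) = @mset0 {classic S'} ->
  (forall m n, h (msetD m n) = msetD (h m) (h n)) ->
  (forall x : S, h [mset (x : {classic S})] = [mset (g x : {classic S'})]) ->
  h = free_cmon_map g.
Proof.
move=> h0 hD h1; apply/funext => m.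
rewrite -(seq_mset_id m); elim: (enum_mset _) => [|x s IHs].
  have -> : @seq_mset {classic S} [::] = mset0.
    by apply/msetP => x; rewrite mset_seqE mset0E.
  by rewrite h0 free_cmon_map0.
have -> : @seq_mset {classic S} (x :: s) = msetD [mset x] (seq_mset s).
  by apply/msetP => y; rewrite mset1DE !mset_seqE /= eq_sym.
by rewrite hD free_cmon_mapD IHs h1 free_cmon_map1.
Qed.

End FreeCmon.

Lemma free_cmon_map_id (S : Type) (m : free_cmon S) :
  free_cmon_map (fun x => x) m = m.
Proof. by rewrite /free_cmon_map map_id; apply: seq_mset_id. Qed.

Lemma free_cmon_map_comp (S S' S'' : Type) (h : S' -> S'') (g : S -> S')
    (m : free_cmon S) :
  free_cmon_map (fun x => h (g x)) m = free_cmon_map h (free_cmon_map g m).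
Proof.
by rewrite [free_cmon_map g m]/free_cmon_map free_cmon_map_perm -map_comp.
Qed.

Record petri_net := PetriNet {
  transition : Type;
  place : Type;
  net_src : transition -> free_cmon place;
  net_tgt : transition -> free_cmon place }.

Record petri_hom (P P' : petri_net) := PetriHom {
  on_transition : transition P -> transition P';
  on_place : place P -> place P';
  hom_src : forall t,
    net_src (on_transition t) = free_cmon_map on_place (net_src t);
  hom_tgt : forall t,
    net_tgt (on_transition t) = free_cmon_map on_place (net_tgt t) }.

Lemma petri_hom_eq (P P' : petri_net) (a b : petri_hom P P') :
  on_transition a = on_transition b -> on_place a = on_place b -> a = b.
Proof.
case: a b => [f g hs ht] [f' g' hs' ht'] /= ef eg.
case: f' / ef hs' ht'; case: g' / eg => hs' ht'.
by rewrite (Prop_irrelevance hs hs') (Prop_irrelevance ht ht').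
Qed.

Definition petri_id (P : petri_net) : petri_hom P P :=
  @PetriHom P P (fun t => t) (fun x => x)
    (fun t => esym (free_cmon_map_id _)) (fun t => esym (free_cmon_map_id _)).

Definition petri_comp (P Q R : petri_net) (b : petri_hom Q R) (a : petri_hom P Q) :
  petri_hom P R.
Proof.
refine (@PetriHom P R (fun t => on_transition b (on_transition a t))
  (fun x => on_place b (on_place a x)) _ _).
- abstract (by move=> t; rewrite !hom_src -free_cmon_map_comp).
- abstract (by move=> t; rewrite !hom_tgt -free_cmon_map_comp).
Defined.

(* Sets are types; by the axioms of [boolp], functions are extensional and
   equality is proof-irrelevant. *)
Definition set_cat : category :=
  @Category Type (fun A B => A -> B) (fun A x => x) (fun A B C g f x => g (f x))
    (fun _ _ _ => erefl) (fun _ _ _ => erefl) (fun _ _ _ _ _ _ _ => erefl).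

Definition petri_cat : category.
Proof.
refine (@Category petri_net petri_hom petri_id petri_comp _ _ _).
all: abstract (by move=> *; apply: petri_hom_eq).
Defined.

Definition L_net (X : set_cat) : petri_cat :=
  @PetriNet Empty_set X (fun t => match t with end) (fun t => match t with end).

(* the morphism LX -> P with a given place component *)
Definition L_hom (X : set_cat) (P : petri_cat) (h : X -> place P) :
    hom (L_net X) P :=
  @PetriHom (L_net X) P (fun t => match t with end) h
    (fun t => match t with end) (fun t => match t with end).

Definition L_map (X Y : set_cat) (f : hom X Y) : hom (L_net X) (L_net Y) :=
  L_hom (P := L_net Y) f.

Lemma L_hom_eq (X : set_cat) (P : petri_cat) (a b : hom (L_net X) P) :
  on_place a = on_place b -> a = b.
Proof. by move=> e; apply: petri_hom_eq => //; apply/funext; case. Qed.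

Lemma L_map1 (X : set_cat) : L_map (idm X) = idm (L_net X).
Proof. exact: L_hom_eq. Qed.

Lemma L_mapM (X Y Z : set_cat) (g : hom Y Z) (f : hom X Y) :
  L_map (g ∘ f) = L_map g ∘ L_map f.
Proof. exact: L_hom_eq. Qed.

(* Pushouts in Petri are only chosen along morphisms out of nets [L_net Y], as
   used for composing open nets. *)
Record colimit_choices := ColimitChoices {
  set_cp : coproducts set_cat;
  set_init : set_cat;
  set_init_initial : initial set_init;
  petri_cp : coproducts petri_cat;
  petri_po : forall (Y : set_cat) (P Q : petri_cat)
    (o : hom (L_net Y) P) (i : hom (L_net Y) Q), pushout o i }.

Record open_net (X Y : set_cat) := OpenNet {
  apex : petri_cat;
  leg_in : hom (L_net X) apex;
  leg_out : hom (L_net Y) apex }.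

Record open_cell (X Y X' Y' : set_cat) (M : open_net X Y) (M' : open_net X' Y') :=
  OpenCell {
    oc_src : hom X X';
    oc_apex : hom (apex M) (apex M');
    oc_tgt : hom Y Y';
    oc_in : oc_apex ∘ leg_in M = leg_in M' ∘ L_map oc_src;
    oc_out : oc_apex ∘ leg_out M = leg_out M' ∘ L_map oc_tgt }.

Definition open_id (X Y : set_cat) (M : open_net X Y) : open_cell M M.
Proof.
refine (@OpenCell _ _ _ _ M M (idm X) (idm (apex M)) (idm Y) _ _).
all: abstract (by rewrite compose1m L_map1 composem1).
Defined.

Definition open_vcomp (X Y X' Y' X'' Y'' : set_cat) (M : open_net X Y)
  (M' : open_net X' Y') (M'' : open_net X'' Y'')
  (beta : open_cell M' M'') (alpha : open_cell M M') : open_cell M M''.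
Proof.
refine (@OpenCell _ _ _ _ M M'' (oc_src beta ∘ oc_src alpha)
  (oc_apex beta ∘ oc_apex alpha) (oc_tgt beta ∘ oc_tgt alpha) _ _).
- abstract (by rewrite L_mapM -composeA oc_in composeA oc_in -composeA).
- abstract (by rewrite L_mapM -composeA oc_out composeA oc_out -composeA).
Defined.

Section OpenPetri.
Variable c : colimit_choices.
Let cpS := set_cp c.
Let cpP := petri_cp c.

(* open nets are composed in the order [Q ⊙ P], with [P] applied first *)
Definition open_po (X Y Z : set_cat) (Q : open_net Y Z) (P : open_net X Y) :=
  petri_po c (leg_out P) (leg_in Q).

Definition open_hcomp (X Y Z : set_cat) (Q : open_net Y Z) (P : open_net X Y) :
    open_net X Z :=
  OpenNet (po_inl (open_po Q P) ∘ leg_in P) (po_inr (open_po Q P) ∘ leg_out Q).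

Lemma open_hcomp_compat (X Y Z X' Y' Z' : set_cat)
    (Q : open_net Y Z) (P : open_net X Y) (Q' : open_net Y' Z')
    (P' : open_net X' Y') (beta : open_cell Q Q') (alpha : open_cell P P') :
  oc_src beta = oc_tgt alpha ->
  (po_inl (open_po Q' P') ∘ oc_apex alpha) ∘ leg_out P
  = (po_inr (open_po Q' P') ∘ oc_apex beta) ∘ leg_in Q.
Proof.
by move=> e; rewrite -!composeA oc_out oc_in e !composeA po_square.
Qed.

Definition open_chcomp (X Y Z X' Y' Z' : set_cat)
  (Q : open_net Y Z) (P : open_net X Y) (Q' : open_net Y' Z')
  (P' : open_net X' Y') (beta : open_cell Q Q') (alpha : open_cell P P')
  (e : oc_src beta = oc_tgt alpha) :
  open_cell (open_hcomp Q P) (open_hcomp Q' P').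
Proof.
refine (@OpenCell _ _ _ _ (open_hcomp Q P) (open_hcomp Q' P')
  (oc_src alpha) (po_map (open_po Q P) (open_hcomp_compat e)) (oc_tgt beta) _ _).
- abstract (by rewrite /= composeA po_map_inl -composeA oc_in composeA).
- abstract (by rewrite /= composeA po_map_inr -composeA oc_out composeA).
Defined.

Definition open_base : dbl_base :=
  @DblBase set_cat open_net open_cell oc_src oc_tgt open_id open_vcomp
    open_hcomp open_chcomp.

(* The canonical isomorphism L(X1 + X2) -> LX1 + LX2 is the map corresponding
   under the adjunction between L and the set-of-places functor to the copairing
   of the place components of the injections; it is the inverse of the map
   [L_cp_inv] = [L inl, L inr]. *)
Definition L_cp (X1 X2 : set_cat) :
    hom (L_net (cpS X1 X2)) (cpP (L_net X1) (L_net X2)) :=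
  L_hom (copair (cpS X1 X2) (X := place (cp_ob (cpP (L_net X1) (L_net X2))))
    (on_place (cp_inl (cpP (L_net X1) (L_net X2))))
    (on_place (cp_inr (cpP (L_net X1) (L_net X2))))).

Definition L_cp_inv (X1 X2 : set_cat) :
    hom (cpP (L_net X1) (L_net X2)) (L_net (cpS X1 X2)) :=
  copair (cpP (L_net X1) (L_net X2))
    (L_map (cp_inl (cpS X1 X2))) (L_map (cp_inr (cpS X1 X2))).

Lemma cp_ext (C : category) (cp : coproducts C) (A B X : C)
    (a b : hom (cp A B) X) :
  a ∘ cp_inl (cp A B) = b ∘ cp_inl (cp A B) ->
  a ∘ cp_inr (cp A B) = b ∘ cp_inr (cp A B) -> a = b.
Proof. by move=> /copair_uniq h /h ->; apply/esym/copair_uniq. Qed.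

Lemma L_cp_ext (X1 X2 : set_cat) (P : petri_cat)
    (a b : hom (L_net (cpS X1 X2)) P) :
  a ∘ L_map (cp_inl (cpS X1 X2)) = b ∘ L_map (cp_inl (cpS X1 X2)) ->
  a ∘ L_map (cp_inr (cpS X1 X2)) = b ∘ L_map (cp_inr (cpS X1 X2)) -> a = b.
Proof.
move=> hl hr; apply: L_hom_eq.
apply: (@cp_ext set_cat cpS X1 X2 (place P)).
  exact: (congr1 (fun u => on_place u) hl).
exact: (congr1 (fun u => on_place u) hr).
Qed.

Lemma L_cp_inl (X1 X2 : set_cat) :
  L_cp X1 X2 ∘ L_map (cp_inl (cpS X1 X2)) = cp_inl (cpP (L_net X1) (L_net X2)).
Proof. by apply: L_hom_eq; apply: (@copair_inl set_cat). Qed.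

Lemma L_cp_inr (X1 X2 : set_cat) :
  L_cp X1 X2 ∘ L_map (cp_inr (cpS X1 X2)) = cp_inr (cpP (L_net X1) (L_net X2)).
Proof. by apply: L_hom_eq; apply: (@copair_inr set_cat). Qed.

Lemma L_cp_inverse (X1 X2 : set_cat) :
  inverse_of (L_cp X1 X2) (L_cp_inv X1 X2).
Proof.
split; [apply: L_cp_ext|apply: cp_ext]; rewrite compose1m -composeA.
- by rewrite L_cp_inl copair_inl.
- by rewrite L_cp_inr copair_inr.
- by rewrite copair_inl L_cp_inl.
- by rewrite copair_inr L_cp_inr.
Qed.

Definition tensor_leg (X1 X2 : set_cat) (P1 P2 : petri_cat)
    (i1 : hom (L_net X1) P1) (i2 : hom (L_net X2) P2) :
    hom (L_net (cpS X1 X2)) (cpP P1 P2) :=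
  cp_map cpP i1 i2 ∘ L_cp X1 X2.

Lemma tensor_leg_inl (X1 X2 : set_cat) (P1 P2 : petri_cat)
    (i1 : hom (L_net X1) P1) (i2 : hom (L_net X2) P2) :
  tensor_leg i1 i2 ∘ L_map (cp_inl (cpS X1 X2)) = cp_inl (cpP P1 P2) ∘ i1.
Proof. by rewrite -composeA L_cp_inl copair_inl. Qed.

Lemma tensor_leg_inr (X1 X2 : set_cat) (P1 P2 : petri_cat)
    (i1 : hom (L_net X1) P1) (i2 : hom (L_net X2) P2) :
  tensor_leg i1 i2 ∘ L_map (cp_inr (cpS X1 X2)) = cp_inr (cpP P1 P2) ∘ i2.
Proof. by rewrite -composeA L_cp_inr copair_inr. Qed.

Lemma tensor_leg_copair (X1 X2 X : set_cat) (P1 P2 P : petri_cat)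
    (i1 : hom (L_net X1) P1) (i2 : hom (L_net X2) P2) (i : hom (L_net X) P)
    (a1 : hom P1 P) (a2 : hom P2 P) (f1 : hom X1 X) (f2 : hom X2 X) :
  a1 ∘ i1 = i ∘ L_map f1 -> a2 ∘ i2 = i ∘ L_map f2 ->
  copair (cpP P1 P2) a1 a2 ∘ tensor_leg i1 i2
  = i ∘ L_map (copair (cpS X1 X2) f1 f2).
Proof.
move=> h1 h2; apply: L_cp_ext; rewrite -[LHS]composeA -[RHS]composeA -L_mapM.
- by rewrite tensor_leg_inl composeA !copair_inl.
- by rewrite tensor_leg_inr composeA !copair_inr.
Qed.

Lemma tensor_leg_inrM (X X1 X2 : set_cat) (P1 P2 : petri_cat)
    (i1 : hom (L_net X1) P1) (i2 : hom (L_net X2) P2) (f : hom X X2) :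
  tensor_leg i1 i2 ∘ L_map (cp_inr (cpS X1 X2) ∘ f)
  = cp_inr (cpP P1 P2) ∘ (i2 ∘ L_map f).
Proof. by rewrite L_mapM composeA tensor_leg_inr composeA. Qed.

Lemma tensor_leg_assoc (X1 X2 X3 : set_cat) (P1 P2 P3 : petri_cat)
    (i1 : hom (L_net X1) P1) (i2 : hom (L_net X2) P2) (i3 : hom (L_net X3) P3) :
  cp_assoc cpP P1 P2 P3 ∘ tensor_leg (tensor_leg i1 i2) i3
  = tensor_leg i1 (tensor_leg i2 i3) ∘ L_map (cp_assoc cpS X1 X2 X3).
Proof.
apply: tensor_leg_copair; first apply: tensor_leg_copair.
- by rewrite tensor_leg_inl.
- by rewrite tensor_leg_inrM tensor_leg_inl composeA.
- by rewrite tensor_leg_inrM tensor_leg_inr composeA.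
Qed.

Definition open_tensor (X1 Y1 X2 Y2 : set_cat) (M1 : open_net X1 Y1)
    (M2 : open_net X2 Y2) : open_net (cpS X1 X2) (cpS Y1 Y2) :=
  OpenNet (tensor_leg (leg_in M1) (leg_in M2))
          (tensor_leg (leg_out M1) (leg_out M2)).

Definition open_tensor_cell (X1 Y1 X2 Y2 X1' Y1' X2' Y2' : set_cat)
  (M1 : open_net X1 Y1) (M2 : open_net X2 Y2)
  (M1' : open_net X1' Y1') (M2' : open_net X2' Y2')
  (a1 : open_cell M1 M1') (a2 : open_cell M2 M2') :
  open_cell (open_tensor M1 M2) (open_tensor M1' M2').
Proof.
refine (@OpenCell _ _ _ _ (open_tensor M1 M2) (open_tensor M1' M2')
  (cp_map cpS (oc_src a1) (oc_src a2)) (cp_map cpP (oc_apex a1) (oc_apex a2))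
  (cp_map cpS (oc_tgt a1) (oc_tgt a2)) _ _).
- abstract (apply: tensor_leg_copair;
    rewrite L_mapM composeA ?tensor_leg_inl ?tensor_leg_inr -!composeA oc_in //).
- abstract (apply: tensor_leg_copair;
    rewrite L_mapM composeA ?tensor_leg_inl ?tensor_leg_inr -!composeA oc_out //).
Defined.

Definition open_assoc (X1 X2 X3 Y1 Y2 Y3 : set_cat) (M1 : open_net X1 Y1)
  (M2 : open_net X2 Y2) (M3 : open_net X3 Y3) :
  open_cell (open_tensor (open_tensor M1 M2) M3)
            (open_tensor M1 (open_tensor M2 M3)).
Proof.
refine (@OpenCell _ _ _ _
  (open_tensor (open_tensor M1 M2) M3) (open_tensor M1 (open_tensor M2 M3))
  (cp_assoc cpS X1 X2 X3) (cp_assoc cpP (apex M1) (apex M2) (apex M3))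
  (cp_assoc cpS Y1 Y2 Y3) _ _).
- abstract exact: tensor_leg_assoc.
- abstract exact: tensor_leg_assoc.
Defined.

Definition open_swap (X1 Y1 X2 Y2 : set_cat) (M1 : open_net X1 Y1)
  (M2 : open_net X2 Y2) :
  open_cell (open_tensor M1 M2) (open_tensor M2 M1).
Proof.
refine (@OpenCell _ _ _ _ (open_tensor M1 M2) (open_tensor M2 M1)
  (cp_swap cpS X1 X2) (cp_swap cpP (apex M1) (apex M2)) (cp_swap cpS Y1 Y2) _ _).
all: abstract (apply: tensor_leg_copair;
  by rewrite ?tensor_leg_inl ?tensor_leg_inr).
Defined.

(* [u] is a unit for the tensor of open nets: its apex is an initial Petri net *)
Section Unit.
Let I := set_init c.
Let hI : initial I := set_init_initial c.
Variables (u : open_net I I) (hu : initial (apex u)).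

Lemma init_L_hom (P : petri_cat) (a b : hom (L_net I) P) : a = b.
Proof.
apply: L_hom_eq.
by rewrite (@init_uniq set_cat I hI (place P) (on_place a))
           (@init_uniq set_cat I hI (place P) (on_place b)).
Qed.

Definition open_lunit (X Y : set_cat) (M : open_net X Y) :
  open_cell (open_tensor u M) M.
Proof.
refine (@OpenCell _ _ _ _ (open_tensor u M) M
  (cp_lunit cpS hI X) (cp_lunit cpP hu (apex M)) (cp_lunit cpS hI Y) _ _).
all: abstract (apply: tensor_leg_copair; first (by apply: init_L_hom);
  by rewrite L_map1 compose1m composem1).
Defined.

Definition open_runit (X Y : set_cat) (M : open_net X Y) :
  open_cell (open_tensor M u) M.
Proof.
refine (@OpenCell _ _ _ _ (open_tensor M u) M
  (cp_runit cpS hI X) (cp_runit cpP hu (apex M)) (cp_runit cpS hI Y) _ _).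
all: abstract (apply: tensor_leg_copair; last (by apply: init_L_hom);
  by rewrite L_map1 compose1m composem1).
Defined.

Definition open_petri_data : sm_data :=
  @SmData open_base cpS (@cp_map _ cpS) open_tensor open_tensor_cell
    I u
    (@cp_assoc _ cpS) open_assoc
    (cp_lunit cpS hI) open_lunit
    (cp_runit cpS hI) open_runit
    (@cp_swap _ cpS) open_swap.

End Unit.

End OpenPetri.

Arguments open_petri_data c u hu : clear implicits.

(* Main.v *)
(* Every structure 2-morphism of Open(Petri) has as apex component a map induced
   by the universal property of a pushout or a coproduct, and every law is an
   equation between maps out of iterated pushouts and coproducts, so it suffices
   to compare both sides on the legs.  Invertibility of the comparison
   (P1 + P2) +_{L(Y1 + Y2)} (Q1 + Q2) -> (P1 +_{LY1} Q1) + (P2 +_{LY2} Q2)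
   and of L(X1 + X2) -> LX1 + LX2, i.e. that colimits commute with colimits and
   that the left adjoint L preserves coproducts, makes the tensor product a double
   functor.  The symmetric monoidal axioms are those of coproducts in Set and in
   Petri, taken componentwise.  Pushouts along LY only glue places, since LY has
   no transitions. *)

From Stdlib Require Import Relation_Operators.
From mathcomp Require Import all_boot boolp.
Require Import Defs.

Set Implicit Arguments.
Unset Strict Implicit.
Unset Printing Implicit Defensive.
Local Open Scope cat_scope.

(** * Quotient of a type by the equivalence relation generated by a relation *)

Section Quotient.
Variables (S : Type) (r : S -> S -> Prop).

Local Notation eqv := (clos_refl_sym_trans S r).

(** Points are equivalence classes, encoded as predicates. By functional and propositional
    extensionality, equivalent elements have Leibniz-equal classes. *)
Definition quotient := {A : S -> Prop | exists x, A = eqv x}.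

Definition quot (x : S) : quotient :=
  exist _ (eqv x) (ex_intro _ x erefl).

Lemma quotient_eq (p q : quotient) : sval p = sval q -> p = q.
Proof. by case: p q => [A hA] [B hB]; apply: eq_exist. Qed.

Lemma quot_eq x y : eqv x y -> quot x = quot y.
Proof.
move=> exy; apply: quotient_eq; apply/funext => z; apply/propext; split => h.
- by apply: rst_trans h; apply: rst_sym.
- exact: rst_trans h.
Qed.

(** A representative picked by choice, so a map out of the quotient is just [f] after [quot_repr].
    That [f] respects [r] matters only for the computation rule [quot_repr_map]. *)
Definition quot_repr (q : quotient) : S := sval (boolp.cid (svalP q)).

Lemma quot_reprK q : quot (quot_repr q) = q.
Proof. by apply: quotient_eq; rewrite /quot_repr; case: boolp.cid => x /= ->. Qed.

Lemma clos_rst_repr x : eqv (quot_repr (quot x)) x.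
Proof.
have := congr1 (fun q => sval q x) (quot_reprK (quot x)) => /= ->.
exact: rst_refl.
Qed.

Lemma clos_rst_map (X : Type) (f : S -> X) :
  (forall x y, r x y -> f x = f y) -> forall x y, eqv x y -> f x = f y.
Proof. by move=> fr x y; elim=> {x y} [x y /fr||//|x y z _ -> _ ->]. Qed.

Lemma quot_repr_map (X : Type) (f : S -> X) x :
  (forall x y, r x y -> f x = f y) -> f (quot_repr (quot x)) = f x.
Proof. by move=> /clos_rst_map; apply; apply: clos_rst_repr. Qed.

End Quotient.

(** * Existence of the colimits to be chosen in Set and Petri *)

Definition set_coproduct (A B : set_cat) : coproduct A B.
Proof.
refine (@Coproduct set_cat A B (A + B)%type inl inr
  (fun X f g x => match x with inl a => f a | inr b => g b end) _ _ _).
- by [].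
- by [].
- by move=> X f g h <- <-; apply/funext => -[].
Defined.

Definition empty_initial : @initial set_cat Empty_set.
Proof.
refine (@Initial set_cat Empty_set (fun X x => match x with end) _).
by move=> X f; apply/funext; case.
Defined.

Section GluedNet.
Variables (P Q : petri_net) (Z : Type) (qP : place P -> Z) (qQ : place Q -> Z).

(** A disjoint union of transitions over an arbitrary place set [Z]. Taking [Z] to be the sum of the
    place sets gives the coproduct; taking a quotient of that sum gives the pushout along [LY]. *)
Definition glued_net : petri_net :=
  @PetriNet (transition P + transition Q) Z
    (fun t => match t with
              | inl t => free_cmon_map qP (net_src t)
              | inr t => free_cmon_map qQ (net_src t) end)
    (fun t => match t with
              | inl t => free_cmon_map qP (net_tgt t)
              | inr t => free_cmon_map qQ (net_tgt t) end).

Definition glued_inl : petri_hom P glued_net :=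
  @PetriHom P glued_net inl qP (fun _ => erefl) (fun _ => erefl).

Definition glued_inr : petri_hom Q glued_net :=
  @PetriHom Q glued_net inr qQ (fun _ => erefl) (fun _ => erefl).

Definition glued_map (X : petri_net) (f : petri_hom P X) (g : petri_hom Q X)
  (h : Z -> place X) (hP : on_place f = fun x => h (qP x))
  (hQ : on_place g = fun x => h (qQ x)) : petri_hom glued_net X.
Proof.
refine (@PetriHom glued_net X
  (fun t => match t with inl t => on_transition f t | inr t => on_transition g t end)
  h _ _).
- by case=> t; rewrite /= hom_src ?hP ?hQ free_cmon_map_comp.
- by case=> t; rewrite /= hom_tgt ?hP ?hQ free_cmon_map_comp.
Defined.

(** Restricting to [P] and [Q] determines the transition component, because transitions form a
    disjoint union. Places need their own hypothesis because [qP] and [qQ] are not assumed jointly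
    surjective. *)
Lemma glued_hom_eq (X : petri_net) (a b : petri_hom glued_net X) :
  petri_comp a glued_inl = petri_comp b glued_inl ->
  petri_comp a glued_inr = petri_comp b glued_inr ->
  on_place a = on_place b -> a = b.
Proof.
move=> el er ep; apply: petri_hom_eq => //; apply/funext => -[t|t].
- exact: (congr1 (fun u => on_transition u t) el).
- exact: (congr1 (fun u => on_transition u t) er).
Qed.

End GluedNet.

Definition petri_coproduct (P Q : petri_cat) : coproduct P Q.
Proof.
pose Z := (place P + place Q)%type.
refine (@Coproduct petri_cat P Q (glued_net (@inl _ _ : _ -> Z) inr)
  (glued_inl _ _) (glued_inr _ _)
  (fun X f g => @glued_map P Q Z inl inr X f g
     (fun x => match x with inl x => on_place f x | inr x => on_place g x end)
     erefl erefl) _ _ _).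
- by move=> X f g; apply: petri_hom_eq.
- by move=> X f g; apply: petri_hom_eq.
- move=> X f g h <- <-; apply: glued_hom_eq; try by apply: petri_hom_eq.
  by apply/funext => -[].
Defined.

Definition petri_pushout (Y : set_cat) (P Q : petri_cat)
  (o : hom (L_net Y) P) (i : hom (L_net Y) Q) : pushout o i.
Proof.
(* The generating relation glues the two images of each point of [Y]. *)
pose r (a b : place P + place Q) :=
  exists y, a = inl (on_place o y) /\ b = inr (on_place i y).
pose q := @quot _ r.
pose m (X : petri_cat) (f : hom P X) (g : hom Q X) a :=
  match a with inl x => on_place f x | inr x => on_place g x end.
have mr X (f : hom P X) (g : hom Q X) (e : f ∘ o = g ∘ i) a b :
    r a b -> m X f g a = m X f g b.
  by case=> y [-> ->] /=; apply: (congr1 (fun u => on_place u y) e).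
(* The induced map evaluates the copairing [m] at a chosen representative; by [mr] the value does
   not depend on the choice. *)
have mP X (f : hom P X) (g : hom Q X) (e : f ∘ o = g ∘ i) :
    on_place f = fun x => m X f g (quot_repr (q (inl x))).
  by apply/funext => x; rewrite (quot_repr_map _ (mr X f g e)).
have mQ X (f : hom P X) (g : hom Q X) (e : f ∘ o = g ∘ i) :
    on_place g = fun x => m X f g (quot_repr (q (inr x))).
  by apply/funext => x; rewrite (quot_repr_map _ (mr X f g e)).
refine (@Pushout petri_cat _ P Q o i
  (glued_net (fun x => q (inl x)) (fun x => q (inr x)))
  (glued_inl _ _) (glued_inr _ _) _
  (fun X f g e => @glued_map P Q _ _ _ X f g
     (fun z => m X f g (quot_repr z)) (mP X f g e) (mQ X f g e)) _ _ _).
- by apply: L_hom_eq; apply/funext => y; apply/quot_eq/rst_step; exists y.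
- by move=> X f g e; apply: petri_hom_eq; rewrite //= -mP.
- by move=> X f g e; apply: petri_hom_eq; rewrite //= -mQ.
- move=> X f g e h hP hQ.
  (* This fixes [h] on classes, and by [quot_reprK] every point of the quotient is a class. *)
  have hq a : on_place h (q a) = m X f g a by rewrite -hP -hQ; case: a.
  apply: glued_hom_eq.
  + by apply: etrans hP _; apply: petri_hom_eq; rewrite //= -mP.
  + by apply: etrans hQ _; apply: petri_hom_eq; rewrite //= -mQ.
  + by apply/funext => z; rewrite /= -hq /q quot_reprK.
Defined.

(** Ensures that quantifying over all choices of colimits is not vacuous. *)
Lemma colimit_choices_exist : inhabited colimit_choices.
Proof.
exact: inhabits (ColimitChoices set_coproduct empty_initial petri_coproduct
  petri_pushout).
Qed.

(** * Joint epimorphy and computation rules for maps out of colimits *)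

Section Universal.
Variable C : category.

Lemma invertible_intro (A B : C) (f : hom A B) (g : hom B A) :
  g ∘ f = idm A -> f ∘ g = idm B -> invertible f.
Proof. by exists g. Qed.

Lemma invertible_idm (A : C) : invertible (idm A).
Proof. by apply: (@invertible_intro _ _ _ (idm A)); rewrite compose1m. Qed.

Lemma initial_eq (I X : C) (f g : hom I X) : initial I -> f = g.
Proof. by move=> hI; rewrite (init_uniq hI f) (init_uniq hI g). Qed.

Lemma coproduct_ext (A B X : C) (p : coproduct A B) (a b : hom p X) :
  a ∘ cp_inl p = b ∘ cp_inl p -> a ∘ cp_inr p = b ∘ cp_inr p -> a = b.
Proof. by move=> /copair_uniq h /h ->; apply/esym/copair_uniq. Qed.

(** The restrictions of [b] to the two legs form a cocone, and both [a] and [b] are the map that it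
    induces. *)
Lemma pushout_ext (Y P Q X : C) (o : hom Y P) (i : hom Y Q) (p : pushout o i)
    (a b : hom p X) :
  a ∘ po_inl p = b ∘ po_inl p -> a ∘ po_inr p = b ∘ po_inr p -> a = b.
Proof.
move=> el er.
have e : (b ∘ po_inl p) ∘ o = (b ∘ po_inr p) ∘ i.
  by rewrite -!composeA po_square.
by rewrite (po_map_uniq e el er); apply/esym/po_map_uniq.
Qed.

Lemma compose_copair_inl (A B X Y : C) (p : coproduct A B) (f : hom A X)
    (g : hom B X) (h : hom X Y) : h ∘ copair p f g ∘ cp_inl p = h ∘ f.
Proof. by rewrite -composeA copair_inl. Qed.

Lemma compose_copair_inr (A B X Y : C) (p : coproduct A B) (f : hom A X)
    (g : hom B X) (h : hom X Y) : h ∘ copair p f g ∘ cp_inr p = h ∘ g.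
Proof. by rewrite -composeA copair_inr. Qed.

Lemma compose_po_map_inl (Y P Q X Z : C) (o : hom Y P) (i : hom Y Q)
    (p : pushout o i) (f : hom P X) (g : hom Q X) (e : f ∘ o = g ∘ i)
    (h : hom X Z) : h ∘ po_map p e ∘ po_inl p = h ∘ f.
Proof. by rewrite -composeA po_map_inl. Qed.

Lemma compose_po_map_inr (Y P Q X Z : C) (o : hom Y P) (i : hom Y Q)
    (p : pushout o i) (f : hom P X) (g : hom Q X) (e : f ∘ o = g ∘ i)
    (h : hom X Z) : h ∘ po_map p e ∘ po_inr p = h ∘ g.
Proof. by rewrite -composeA po_map_inr. Qed.

End Universal.

Definition universal_simpl (C : category) := (@compose_po_map_inl C,
  @compose_po_map_inr C, @compose_copair_inl C, @compose_copair_inr C).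

(* Composites are associated to the left and start with an identity, so that
   every redex has the form [h ∘ u ∘ v].  The category is fixed because in
   [set_cat] every function [f] unifies with a composite [?g ∘ ?f], so that
   rewriting with associativity would loop. *)
Ltac cat_simpl C :=
  rewrite -[LHS](@compose1m C) -[RHS](@compose1m C);
  repeat (progress rewrite ?(@composeA C) ?(@composem1 C) ?(universal_simpl C));
  rewrite ?(@compose1m C).

Ltac diagram C :=
  repeat first [apply: (@pushout_ext C) | apply: (@coproduct_ext C)];
  cat_simpl C; try by [].

(** * The symmetric monoidal structure given by coproducts and an initial object *)

Section Coproducts.
Variables (C : category) (cp : coproducts C) (I : C) (hI : initial I).

Lemma cp_map1 (A B : C) : cp_map cp (idm A) (idm B) = idm (cp A B).
Proof. by diagram C. Qed.

Lemma cp_mapM (A B A' B' A'' B'' : C) (f' : hom A' A'') (f : hom A A')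
    (g' : hom B' B'') (g : hom B B') :
  cp_map cp (f' ∘ f) (g' ∘ g) = cp_map cp f' g' ∘ cp_map cp f g.
Proof. by diagram C. Qed.

Lemma cp_assoc_nat (A B D A' B' D' : C) (f : hom A A') (g : hom B B')
    (h : hom D D') :
  cp_assoc cp A' B' D' ∘ cp_map cp (cp_map cp f g) h
  = cp_map cp f (cp_map cp g h) ∘ cp_assoc cp A B D.
Proof. by diagram C. Qed.

(** An explicit inverse is needed for the second hexagon, where [inverse_of_uniq] substitutes it for
    the arbitrary inverse [v]. *)
Definition cp_assoc_inv (A B D : C) : hom (cp A (cp B D)) (cp (cp A B) D) :=
  copair (cp A (cp B D)) (cp_inl (cp (cp A B) D) ∘ cp_inl (cp A B))
    (cp_map cp (cp_inr (cp A B)) (idm D)).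

Lemma cp_assoc_inverse (A B D : C) :
  inverse_of (cp_assoc cp A B D) (cp_assoc_inv A B D).
Proof. by split; rewrite /cp_assoc_inv; diagram C. Qed.

Lemma cp_assoc_invertible (A B D : C) : invertible (cp_assoc cp A B D).
Proof. by exists (cp_assoc_inv A B D); apply: cp_assoc_inverse. Qed.

Lemma cp_lunit_nat (A B : C) (f : hom A B) :
  cp_lunit cp hI B ∘ cp_map cp (idm I) f = f ∘ cp_lunit cp hI A.
Proof. by diagram C; apply: initial_eq. Qed.

Lemma cp_lunit_invertible (A : C) : invertible (cp_lunit cp hI A).
Proof.
apply: (@invertible_intro _ _ _ _ (cp_inr (cp I A))); diagram C => //.
exact: initial_eq.
Qed.

Lemma cp_runit_nat (A B : C) (f : hom A B) :
  cp_runit cp hI B ∘ cp_map cp f (idm I) = f ∘ cp_runit cp hI A.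
Proof. by diagram C; apply: initial_eq. Qed.

Lemma cp_runit_invertible (A : C) : invertible (cp_runit cp hI A).
Proof.
apply: (@invertible_intro _ _ _ _ (cp_inl (cp A I))); diagram C => //.
exact: initial_eq.
Qed.

Lemma cp_swap_nat (A B A' B' : C) (f : hom A A') (g : hom B B') :
  cp_swap cp A' B' ∘ cp_map cp f g = cp_map cp g f ∘ cp_swap cp A B.
Proof. by diagram C. Qed.

Lemma cp_swapK (A B : C) : cp_swap cp B A ∘ cp_swap cp A B = idm (cp A B).
Proof. by diagram C. Qed.

Lemma cp_swap_invertible (A B : C) : invertible (cp_swap cp A B).
Proof. exact: invertible_intro (cp_swapK A B) (cp_swapK B A). Qed.

Lemma inverse_of_uniq (A B : C) (f : hom A B) (g g' : hom B A) :
  inverse_of f g -> inverse_of f g' -> g = g'.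
Proof.
by move=> [gf _] [_ fg']; rewrite -[g]composem1 -fg' composeA gf compose1m.
Qed.

Lemma coproduct_coherence :
  @sm_coherence C cp (@cp_map C cp) I (cp_assoc cp) (cp_lunit cp hI)
    (cp_runit cp hI) (cp_swap cp).
Proof.
split.
- by move=> A B D E; diagram C.
- by move=> A B; diagram C => //; apply: initial_eq.
- exact: cp_swapK.
- by move=> A B D; diagram C.
- move=> A B D v /inverse_of_uniq/(_ (cp_assoc_inverse A D B)) ->.
  by rewrite /cp_assoc_inv; diagram C.
Qed.

End Coproducts.

(* Otherwise [/=] turns [hom petri_cat] into [petri_hom], to which [pushout_ext]
   and [coproduct_ext] do not apply. *)
Arguments hom {c} A B : simpl never.

(** * Equality, inversion and construction of 2-morphisms between open nets *)

Lemma open_cell_eq (X Y X' Y' : set_cat) (M : open_net X Y) (M' : open_net X' Y')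
    (a b : open_cell M M') :
  oc_src a = oc_src b -> oc_apex a = oc_apex b -> oc_tgt a = oc_tgt b -> a = b.
Proof.
case: a b => [f h g hi ho] [f' h' g' hi' ho'] /= ef eh eg.
case: f' / ef hi'; case: h' / eh ho'; case: g' / eg => ho' hi'.
by rewrite (Prop_irrelevance hi hi') (Prop_irrelevance ho ho').
Qed.

(** Here [a' i' = a' i' f f' = a' a i f' = i f']. Hence the componentwise inverse of a 2-morphism
    again commutes with the legs. *)
Lemma leg_inverse (C : category) (X X' P P' : C) (f : hom X X') (f' : hom X' X)
    (a : hom P P') (a' : hom P' P) (i : hom X P) (i' : hom X' P') :
  inverse_of f f' -> inverse_of a a' -> a ∘ i = i' ∘ f -> a' ∘ i' = i ∘ f'.
Proof.
move=> [_ ff'] [a'a _] h.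
by rewrite -[i']composem1 -ff' (composeA i') -h !composeA a'a compose1m.
Qed.

Lemma L_map_inverse (X Y : set_cat) (f : hom X Y) (g : hom Y X) :
  inverse_of f g -> inverse_of (L_map f) (L_map g).
Proof. by move=> [h1 h2]; split; rewrite -L_mapM ?h1 ?h2 L_map1. Qed.

(** The vertical components are literally identities, so globularity of the cells built this way
    holds by conversion. *)
Definition globular_cell (X Y : set_cat) (M M' : open_net X Y)
  (a : hom (apex M) (apex M')) (hi : a ∘ leg_in M = leg_in M')
  (ho : a ∘ leg_out M = leg_out M') : open_cell M M'.
Proof.
refine (@OpenCell _ _ _ _ M M' (idm X) a (idm Y) _ _).
all: abstract (by rewrite L_map1 composem1).
Defined.

Lemma oc_apex_vcomp (X Y X' Y' X'' Y'' : set_cat) (M : open_net X Y)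
    (M' : open_net X' Y') (M'' : open_net X'' Y'') (b : open_cell M' M'')
    (a : open_cell M M') : oc_apex (open_vcomp b a) = oc_apex b ∘ oc_apex a.
Proof. by []. Qed.

Lemma oc_apex_id (X Y : set_cat) (M : open_net X Y) :
  oc_apex (open_id M) = idm (apex M).
Proof. by []. Qed.

(* Only the structure of [dbl_cat] is unfolded: unfolding the apex maps as well
   makes the terms grow exponentially with the number of nested pushouts. *)
Ltac unfold_base := cbn [ccomp chcomp cid open_base hcomp hor cell dbl0].

Ltac apex_simpl :=
  rewrite -[LHS](@compose1m petri_cat) -[RHS](@compose1m petri_cat);
  repeat (progress rewrite ?oc_apex_vcomp ?oc_apex_id ?(@composeA petri_cat)
    ?(@composem1 petri_cat) ?(universal_simpl petri_cat));
  rewrite ?(@compose1m petri_cat).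

Ltac apex_diagram :=
  repeat first [apply: (@pushout_ext petri_cat) | apply: (@coproduct_ext petri_cat)];
  apex_simpl; try by [].

(** * The double category of open Petri nets *)

Section OpenDouble.
Variable c : colimit_choices.

Lemma open_cell_invertible (X Y X' Y' : set_cat) (M : open_net X Y)
    (M' : open_net X' Y') (a : open_cell M M') :
  invertible (oc_src a) -> invertible (oc_apex a) -> invertible (oc_tgt a) ->
  cinvertible (D := open_base c) a.
Proof.
move=> [f hf] [h hh] [g hg].
have ei := leg_inverse (L_map_inverse hf) hh (oc_in a).
have eo := leg_inverse (L_map_inverse hg) hh (oc_out a).
exists (OpenCell ei eo); case: hf hh hg => [? ?] [? ?] [? ?].
by split; apply: open_cell_eq.
Qed.

Lemma globular_cell_invertible (X Y : set_cat) (M M' : open_net X Y)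
    (a : open_cell M M') :
  globular (D := open_base c) a -> invertible (oc_apex a) ->
  cinvertible (D := open_base c) a.
Proof.
move=> [/= h1 h2] ?; apply: open_cell_invertible => //;
  rewrite ?h1 ?h2; exact: invertible_idm.
Qed.

Definition open_hunit (X : set_cat) : open_net X X :=
  OpenNet (idm (L_net X)) (idm (L_net X)).

Definition open_cunit (X Y : set_cat) (f : hom X Y) :
  open_cell (open_hunit X) (open_hunit Y).
Proof.
refine (@OpenCell _ _ _ _ (open_hunit X) (open_hunit Y) f (L_map f) f _ _).
all: abstract (by rewrite compose1m composem1).
Defined.

Local Notation "M ⊙ N" := (open_hcomp c M N).
Local Notation po M N := (open_po c M N).

Section Associator.
Variables (X Y Z W : set_cat) (M : open_net Z W) (N : open_net Y Z)
  (P : open_net X Y).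

(** The cocone inducing the restriction of the associator to the apex of [M ⊙ N]; the outer square
    then extends it by the apex of [P]. *)
Lemma assoc_inner_square :
  (po_inl (po M (N ⊙ P)) ∘ po_inr (po N P)) ∘ leg_out N
  = po_inr (po M (N ⊙ P)) ∘ leg_in M.
Proof. by rewrite -po_square composeA. Qed.

Lemma assoc_outer_square :
  (po_inl (po M (N ⊙ P)) ∘ po_inl (po N P)) ∘ leg_out P
  = po_map (po M N) assoc_inner_square ∘ leg_in (M ⊙ N).
Proof. by rewrite /=; diagram petri_cat; rewrite -!composeA po_square. Qed.

Lemma assoc_inv_inner_square :
  po_inl (po (M ⊙ N) P) ∘ leg_out P
  = (po_inr (po (M ⊙ N) P) ∘ po_inl (po M N)) ∘ leg_in N.
Proof. by rewrite po_square composeA. Qed.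

Lemma assoc_inv_outer_square :
  po_map (po N P) assoc_inv_inner_square ∘ leg_out (N ⊙ P)
  = (po_inr (po (M ⊙ N) P) ∘ po_inr (po M N)) ∘ leg_in M.
Proof. by rewrite /=; diagram petri_cat; rewrite -!composeA po_square. Qed.

Definition open_hassoc : open_cell (M ⊙ N ⊙ P) (M ⊙ (N ⊙ P)).
Proof.
refine (@globular_cell _ _ (M ⊙ N ⊙ P) (M ⊙ (N ⊙ P))
  (po_map (po (M ⊙ N) P) assoc_outer_square) _ _).
all: abstract (by rewrite /=; diagram petri_cat).
Defined.

Lemma open_hassoc_invertible : cinvertible (D := open_base c) open_hassoc.
Proof.
apply: globular_cell_invertible => //.
apply: (@invertible_intro _ _ _ _ (po_map (po M (N ⊙ P)) assoc_inv_outer_square));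
  by rewrite /=; diagram petri_cat.
Qed.

End Associator.

Lemma hlunit_square (X Y : set_cat) (N : open_net X Y) :
  idm (apex N) ∘ leg_out N = leg_out N ∘ leg_in (open_hunit Y).
Proof. by rewrite compose1m composem1. Qed.

Definition open_hlunit (X Y : set_cat) (N : open_net X Y) :
  open_cell (open_hunit Y ⊙ N) N.
Proof.
refine (@globular_cell _ _ (open_hunit Y ⊙ N) N
  (po_map (po (open_hunit Y) N) (hlunit_square N)) _ _).
all: abstract (by rewrite /=; diagram petri_cat).
Defined.

Lemma hrunit_square (X Y : set_cat) (N : open_net X Y) :
  leg_in N ∘ leg_out (open_hunit X) = idm (apex N) ∘ leg_in N.
Proof. by rewrite compose1m composem1. Qed.

Definition open_hrunit (X Y : set_cat) (N : open_net X Y) :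
  open_cell (N ⊙ open_hunit X) N.
Proof.
refine (@globular_cell _ _ (N ⊙ open_hunit X) N
  (po_map (po N (open_hunit X)) (hrunit_square N)) _ _).
all: abstract (by rewrite /=; diagram petri_cat).
Defined.

(** A pushout along an identity is an isomorphism. The inverse is the injection of the apex of [N],
    and the pushout square expresses the injection of [LY] through it. *)
Lemma open_hlunit_invertible (X Y : set_cat) (N : open_net X Y) :
  cinvertible (D := open_base c) (open_hlunit N).
Proof.
apply: globular_cell_invertible => //.
apply: (@invertible_intro _ _ _ _ (po_inl (po (open_hunit Y) N))); rewrite /=;
  last by diagram petri_cat.
by diagram petri_cat; rewrite po_square composem1.
Qed.

Lemma open_hrunit_invertible (X Y : set_cat) (N : open_net X Y) :
  cinvertible (D := open_base c) (open_hrunit N).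
Proof.
apply: globular_cell_invertible => //.
apply: (@invertible_intro _ _ _ _ (po_inr (po N (open_hunit X)))); rewrite /=;
  last by diagram petri_cat.
by diagram petri_cat; rewrite -po_square composem1.
Qed.

Definition open_dbl : dbl_cat.
Proof.
refine {| dbl_base_of := open_base c;
  hunit := open_hunit; cunit := open_cunit; hassoc := open_hassoc;
  hlunit := open_hlunit; hrunit := open_hrunit |}.
- abstract (by intros; apply: open_cell_eq; rewrite //= compose1m).
- abstract (by intros; apply: open_cell_eq; rewrite //= composem1).
- abstract (by intros; apply: open_cell_eq; rewrite //= composeA).
- by [].
- by [].
- by [].
- by [].
- by [].
- by [].
- abstract (by intros; apply: open_cell_eq; rewrite //= L_map1).
- abstract (by intros; apply: open_cell_eq; rewrite //= L_mapM).
- by [].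
- by [].
- abstract (by intros; apply: open_cell_eq => //; unfold_base; apex_diagram).
- abstract (by intros; apply: open_cell_eq => //; unfold_base; apex_diagram).
- exact: open_hassoc_invertible.
- by [].
- abstract (by intros; apply: open_cell_eq => //; unfold_base; apex_diagram).
- exact: open_hlunit_invertible.
- by [].
(* On the summand coming from the unit, naturality is the square of the 2-morphism with the outgoing
   legs. *)
- abstract (by intros; apply: open_cell_eq => //; unfold_base; apex_diagram;
    rewrite /= oc_out).
- exact: open_hrunit_invertible.
- by [].
- abstract (by intros; apply: open_cell_eq => //; unfold_base; apex_diagram;
    rewrite /= oc_in).
- abstract (by intros; apply: open_cell_eq => //; unfold_base; apex_diagram).
(* On the middle unit, the two sides of the triangle include [LB] through [N] and through [M]; the
   pushout square identifies them. *)
- abstract (by intros; apply: open_cell_eq => //; unfold_base; apex_diagram;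
    rewrite -po_square).
Defined.

End OpenDouble.

(** * Restriction along coproduct injections, in Petri and under [L] *)

Lemma square_restrict (C : category) (Y P Q Z Y' P' Q' : C) (o : hom Y P)
    (i : hom Y Q) (k : hom P Z) (l : hom Q Z) (y : hom Y' Y) (p : hom P' P)
    (q : hom Q' Q) (o' : hom Y' P') (i' : hom Y' Q') :
  k ∘ o = l ∘ i -> o ∘ y = p ∘ o' -> i ∘ y = q ∘ i' ->
  (k ∘ p) ∘ o' = (l ∘ q) ∘ i'.
Proof. by move=> h ho hi; rewrite -!composeA -ho -hi !composeA h. Qed.

Lemma compose_L_cp_inl (c : colimit_choices) (X1 X2 : set_cat) (P : petri_cat)
    (h : hom (petri_cp c (L_net X1) (L_net X2)) P) :
  h ∘ L_cp c X1 X2 ∘ L_map (cp_inl (set_cp c X1 X2)) = h ∘ cp_inl (petri_cp c _ _).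
Proof. by rewrite -composeA L_cp_inl. Qed.

Lemma compose_L_cp_inr (c : colimit_choices) (X1 X2 : set_cat) (P : petri_cat)
    (h : hom (petri_cp c (L_net X1) (L_net X2)) P) :
  h ∘ L_cp c X1 X2 ∘ L_map (cp_inr (set_cp c X1 X2)) = h ∘ cp_inr (petri_cp c _ _).
Proof. by rewrite -composeA L_cp_inr. Qed.

Lemma compose_L_map_copair_inl (X1 X2 X : set_cat) (p : coproduct X1 X2)
    (f : hom X1 X) (g : hom X2 X) (P : petri_cat) (h : hom (L_net X) P) :
  h ∘ L_map (copair p f g) ∘ L_map (cp_inl p) = h ∘ L_map f.
Proof. by rewrite -composeA -L_mapM copair_inl. Qed.

Lemma compose_L_map_copair_inr (X1 X2 X : set_cat) (p : coproduct X1 X2)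
    (f : hom X1 X) (g : hom X2 X) (P : petri_cat) (h : hom (L_net X) P) :
  h ∘ L_map (copair p f g) ∘ L_map (cp_inr p) = h ∘ L_map g.
Proof. by rewrite -composeA -L_mapM copair_inr. Qed.

Definition L_simpl := (compose_L_map_copair_inl, compose_L_map_copair_inr,
  compose_L_cp_inl, compose_L_cp_inr).

(** [L_mapM] is applied to explicit composites only, since in [set_cat] every function unifies with
    a composite. *)
Ltac L_diagram :=
  repeat apply: L_cp_ext;
  rewrite -[LHS](@compose1m petri_cat) -[RHS](@compose1m petri_cat);
  repeat (progress (
    repeat match goal with |- context [L_map (?g ∘ ?f)] => rewrite (L_mapM g f) end;
    rewrite ?oc_apex_vcomp ?oc_apex_id ?(@composeA petri_cat) ?(@composem1 petri_cat)
      ?L_simpl ?(universal_simpl petri_cat)));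
  try by [].

(** * The tensor product and its unit as double functors *)

Section Monoidal.
Variable c : colimit_choices.
Local Notation cpS := (set_cp c).
Local Notation cpP := (petri_cp c).
Local Notation I := (set_init c).
Local Notation hI := (set_init_initial c).
Local Notation D := (open_dbl c).
Local Notation "M ⊙ N" := (open_hcomp c M N).
Local Notation "M ⊠ N" := (open_tensor c M N) (at level 38).
Local Notation "a ⊗ b" := (open_tensor_cell c a b) (at level 38).
Local Notation "b • a" := (open_vcomp b a).
Local Notation po M N := (open_po c M N).

Lemma cp_map_tensor_leg (X1 X2 : set_cat) (P1 P2 Q1 Q2 : petri_cat)
    (i1 : hom (L_net X1) P1) (i2 : hom (L_net X2) P2) (a1 : hom P1 Q1)
    (a2 : hom P2 Q2) :
  cp_map cpP a1 a2 ∘ tensor_leg c i1 i2 = tensor_leg c (a1 ∘ i1) (a2 ∘ i2).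
Proof. by rewrite /tensor_leg cp_mapM !composeA. Qed.

Lemma tensor_leg1 (X1 X2 : set_cat) :
  tensor_leg c (idm (L_net X1)) (idm (L_net X2)) = L_cp c X1 X2.
Proof. by rewrite /tensor_leg cp_map1 compose1m. Qed.

Section Comparison.
Variables (X1 Y1 Z1 X2 Y2 Z2 : set_cat) (M1 : open_net Y1 Z1)
  (M2 : open_net Y2 Z2) (N1 : open_net X1 Y1) (N2 : open_net X2 Y2).

(** This is the coproduct of the two pushout squares, precomposed with the isomorphism from
    [L(Y1 + Y2)] to [LY1 + LY2]. *)
Lemma tensor_comp_square :
  cp_map cpP (po_inl (po M1 N1)) (po_inl (po M2 N2)) ∘ leg_out (N1 ⊠ N2)
  = cp_map cpP (po_inr (po M1 N1)) (po_inr (po M2 N2)) ∘ leg_in (M1 ⊠ M2).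
Proof. by rewrite /= !cp_map_tensor_leg !po_square. Qed.

Definition tensor_comp :
  open_cell ((M1 ⊠ M2) ⊙ (N1 ⊠ N2)) ((M1 ⊙ N1) ⊠ (M2 ⊙ N2)).
Proof.
refine (@globular_cell _ _ ((M1 ⊠ M2) ⊙ (N1 ⊠ N2)) ((M1 ⊙ N1) ⊠ (M2 ⊙ N2))
  (po_map (po (M1 ⊠ M2) (N1 ⊠ N2)) tensor_comp_square) _ _).
all: abstract (by rewrite /= composeA ?po_map_inl ?po_map_inr cp_map_tensor_leg).
Defined.

Lemma tensor_comp_inl_square :
  (po_inl (po (M1 ⊠ M2) (N1 ⊠ N2)) ∘ cp_inl (cpP _ _)) ∘ leg_out N1
  = (po_inr (po (M1 ⊠ M2) (N1 ⊠ N2)) ∘ cp_inl (cpP _ _)) ∘ leg_in M1.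
Proof.
exact: square_restrict (po_square (po (M1 ⊠ M2) (N1 ⊠ N2)))
  (tensor_leg_inl c _ _) (tensor_leg_inl c _ _).
Qed.

Lemma tensor_comp_inr_square :
  (po_inl (po (M1 ⊠ M2) (N1 ⊠ N2)) ∘ cp_inr (cpP _ _)) ∘ leg_out N2
  = (po_inr (po (M1 ⊠ M2) (N1 ⊠ N2)) ∘ cp_inr (cpP _ _)) ∘ leg_in M2.
Proof.
exact: square_restrict (po_square (po (M1 ⊠ M2) (N1 ⊠ N2)))
  (tensor_leg_inr c _ _) (tensor_leg_inr c _ _).
Qed.

(** Coproducts commute with pushouts: restricting the large pushout square to each summand induces a
    map out of each small pushout, and the copairing of these two maps is the inverse. *)
Lemma tensor_comp_invertible : cinvertible (D := open_base c) tensor_comp.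
Proof.
apply: globular_cell_invertible => //.
apply: (@invertible_intro _ _ _ _ (copair (cpP _ _)
  (po_map (po M1 N1) tensor_comp_inl_square)
  (po_map (po M2 N2) tensor_comp_inr_square))); rewrite /=.
- by diagram petri_cat.
- by diagram petri_cat.
Qed.

End Comparison.

Definition tensor_unit_cell (X1 X2 : set_cat) :
  open_cell (open_hunit (cpS X1 X2)) (open_hunit X1 ⊠ open_hunit X2).
Proof.
refine (@globular_cell _ _ (open_hunit (cpS X1 X2)) (open_hunit X1 ⊠ open_hunit X2)
  (L_cp c X1 X2) _ _).
all: abstract (by rewrite /= tensor_leg1 composem1).
Defined.

Lemma tensor_unit_cell_invertible (X1 X2 : set_cat) :
  cinvertible (D := open_base c) (tensor_unit_cell X1 X2).
Proof.
apply: globular_cell_invertible => //.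
by exists (L_cp_inv c X1 X2); apply: L_cp_inverse.
Qed.

Lemma tensor_comp_nat (X1 Y1 Z1 X2 Y2 Z2 X1' Y1' Z1' X2' Y2' Z2' : set_cat)
    (M1 : open_net Y1 Z1) (M2 : open_net Y2 Z2)
    (N1 : open_net X1 Y1) (N2 : open_net X2 Y2)
    (M1' : open_net Y1' Z1') (M2' : open_net Y2' Z2')
    (N1' : open_net X1' Y1') (N2' : open_net X2' Y2')
    (b1 : open_cell M1 M1') (b2 : open_cell M2 M2')
    (a1 : open_cell N1 N1') (a2 : open_cell N2 N2')
    e1 e2 (e : oc_src (b1 ⊗ b2) = oc_tgt (a1 ⊗ a2)) :
  tensor_comp M1' M2' N1' N2' • open_chcomp c e
  = (open_chcomp (beta := b1) (alpha := a1) c e1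
     ⊗ open_chcomp (beta := b2) (alpha := a2) c e2) • tensor_comp M1 M2 N1 N2.
Proof. by apply: open_cell_eq => //; rewrite !oc_apex_vcomp; apex_diagram. Qed.

Lemma tensor_unit_cell_nat (X1 X2 Y1 Y2 : set_cat) (f1 : hom X1 Y1)
    (f2 : hom X2 Y2) :
  tensor_unit_cell Y1 Y2 • open_cunit (cp_map cpS f1 f2)
  = (open_cunit f1 ⊗ open_cunit f2) • tensor_unit_cell X1 X2.
Proof. by apply: open_cell_eq => //; L_diagram. Qed.

Lemma tensor_comp_assoc (X1 Y1 Z1 W1 X2 Y2 Z2 W2 : set_cat)
    (M1 : open_net Z1 W1) (N1 : open_net Y1 Z1) (P1 : open_net X1 Y1)
    (M2 : open_net Z2 W2) (N2 : open_net Y2 Z2) (P2 : open_net X2 Y2) e1 e2 :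
  (open_hassoc c M1 N1 P1 ⊗ open_hassoc c M2 N2 P2)
    • tensor_comp (M1 ⊙ N1) (M2 ⊙ N2) P1 P2
    • open_chcomp (beta := tensor_comp M1 M2 N1 N2) (alpha := open_id (P1 ⊠ P2)) c e1
  = tensor_comp M1 M2 (N1 ⊙ P1) (N2 ⊙ P2)
    • open_chcomp (beta := open_id (M1 ⊠ M2)) (alpha := tensor_comp N1 N2 P1 P2) c e2
    • open_hassoc c (M1 ⊠ M2) (N1 ⊠ N2) (P1 ⊠ P2).
Proof.
apply: open_cell_eq; [by rewrite /= cp_map1 | | by rewrite /= cp_map1].
by rewrite !oc_apex_vcomp; apex_diagram.
Qed.

Lemma tensor_comp_lunit (X1 Y1 X2 Y2 : set_cat) (N1 : open_net X1 Y1)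
    (N2 : open_net X2 Y2) e :
  (open_hlunit c N1 ⊗ open_hlunit c N2)
    • tensor_comp (open_hunit Y1) (open_hunit Y2) N1 N2
    • open_chcomp (beta := tensor_unit_cell Y1 Y2) (alpha := open_id (N1 ⊠ N2)) c e
  = open_hlunit c (N1 ⊠ N2).
Proof.
apply: open_cell_eq; [by rewrite /= cp_map1 | | by rewrite /= cp_map1].
(* The second injection starts at [L(Y1 + Y2)], which is not a chosen coproduct of Petri, so it is
   tested on the images under [L] of the injections. *)
rewrite !oc_apex_vcomp; apply: (@pushout_ext petri_cat); last by L_diagram.
by apex_diagram.
Qed.

Lemma tensor_comp_runit (X1 Y1 X2 Y2 : set_cat) (N1 : open_net X1 Y1)
    (N2 : open_net X2 Y2) e :
  (open_hrunit c N1 ⊗ open_hrunit c N2)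
    • tensor_comp N1 N2 (open_hunit X1) (open_hunit X2)
    • open_chcomp (beta := open_id (N1 ⊠ N2)) (alpha := tensor_unit_cell X1 X2) c e
  = open_hrunit c (N1 ⊠ N2).
Proof.
apply: open_cell_eq; [by rewrite /= cp_map1 | | by rewrite /= cp_map1].
rewrite !oc_apex_vcomp; apply: (@pushout_ext petri_cat); first by L_diagram.
by apex_diagram.
Qed.

Definition open_tensorF : dbl_functor (prod_dbl D D) D.
Proof.
refine (@DblFunctor (prod_dbl D D) D
  (fun X => cpS X.1 X.2) (fun X Y f => cp_map cpS f.1 f.2) _ _
  (fun X Y M => M.1 ⊠ M.2) (fun X Y X' Y' M M' a => a.1 ⊗ a.2)
  _ _ _ _
  (fun X Y Z M N => tensor_comp M.1 M.2 N.1 N.2) _ _ _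
  (fun X => tensor_unit_cell X.1 X.2) _ _ _ _ _ _).
- abstract (by intros; apply: (@cp_map1 set_cat)).
- abstract (by intros; apply: (@cp_mapM set_cat)).
- abstract (by intros; apply: open_cell_eq; rewrite /= cp_map1).
- abstract (by intros; apply: open_cell_eq; rewrite /= cp_mapM).
- by [].
- by [].
- by intros; apply: tensor_comp_invertible.
- by [].
- abstract (by intros; apply: tensor_comp_nat).
- by intros; apply: tensor_unit_cell_invertible.
- by [].
- abstract (by intros; apply: tensor_unit_cell_nat).
- abstract (by intros; apply: tensor_comp_assoc).
- abstract (by intros; apply: tensor_comp_lunit).
- abstract (by intros; apply: tensor_comp_runit).
Defined.

(** As a left adjoint, [L] preserves initial objects; thus the apex of the horizontal unit on [I] is
    initial, as the tensor unit of open nets requires. *)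
Definition L_init : @initial petri_cat (L_net I).
Proof.
exact: (@Initial petri_cat (L_net I) (fun P => L_hom (init_map hI (place P)))
  (fun P f => init_L_hom f _)).
Defined.

(** The composition comparison is the left unitor at the horizontal unit on [I]; the right unit law
    then says that both unitors agree there. *)
Definition open_unitF : dbl_functor terminal_dbl D.
Proof.
refine (@DblFunctor terminal_dbl D
  (fun _ => I) (fun _ _ _ => idm I) _ _
  (fun _ _ _ => open_hunit I) (fun _ _ _ _ _ _ _ => open_id (open_hunit I))
  _ _ _ _
  (fun _ _ _ _ _ => open_hlunit c (open_hunit I)) _ _ _
  (fun _ => open_id (open_hunit I)) _ _ _ _ _ _).
- by [].
- by [].
- by [].
- abstract (by intros; apply: open_cell_eq; rewrite //= compose1m).
- by [].
- by [].
- by intros; apply: open_hlunit_invertible.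
- by [].
- abstract (by intros; apply: open_cell_eq; rewrite //=; diagram petri_cat).
- by intros; apply: cid_inv.
- by [].
- abstract (by intros; apply: open_cell_eq; rewrite //= L_map1).
- abstract (by intros; apply: open_cell_eq; rewrite //=; diagram petri_cat).
- abstract (by intros; apply: open_cell_eq; rewrite //=; diagram petri_cat).
- abstract (by intros; apply: open_cell_eq; rewrite //=; diagram petri_cat).
Defined.

(** * Naturality of the constraints and their compatibility with the comparisons *)

Section AssociatorLaws.
Variables (X1 Y1 Z1 X2 Y2 Z2 X3 Y3 Z3 : set_cat)
  (M1 : open_net Y1 Z1) (M2 : open_net Y2 Z2) (M3 : open_net Y3 Z3)
  (N1 : open_net X1 Y1) (N2 : open_net X2 Y2) (N3 : open_net X3 Y3).

(** The identity 2-morphisms come from the comparisons of the projection functors inside [tensor3l]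
    and [tensor3r]. They are kept so that the statement matches the unfolded law of a
    transformation. *)
Lemma open_assoc_comp
    (e : oc_src (open_assoc c M1 M2 M3) = oc_tgt (open_assoc c N1 N2 N3)) :
  open_assoc c (M1 ⊙ N1) (M2 ⊙ N2) (M3 ⊙ N3)
    • (((open_id (M1 ⊙ N1) ⊗ open_id (M2 ⊙ N2)) • tensor_comp M1 M2 N1 N2)
         ⊗ open_id (M3 ⊙ N3)
       • tensor_comp (M1 ⊠ M2) M3 (N1 ⊠ N2) N3)
  = ((open_id (M1 ⊙ N1) • open_id (M1 ⊙ N1))
       ⊗ (((open_id (M2 ⊙ N2) • open_id (M2 ⊙ N2)) ⊗ open_id (M3 ⊙ N3))
          • tensor_comp M2 M3 N2 N3)
     • tensor_comp M1 (M2 ⊠ M3) N1 (N2 ⊠ N3))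
    • open_chcomp c e.
Proof.
apply: open_cell_eq; [by rewrite /= !cp_map1 | | by rewrite /= !cp_map1].
by rewrite !oc_apex_vcomp; apex_diagram.
Qed.

Lemma open_assoc_unit :
  open_assoc c (open_hunit X1) (open_hunit X2) (open_hunit X3)
    • (((open_id (open_hunit X1) ⊗ open_id (open_hunit X2)) • tensor_unit_cell X1 X2)
         ⊗ open_id (open_hunit X3)
       • tensor_unit_cell (cpS X1 X2) X3)
  = ((open_id (open_hunit X1) • open_id (open_hunit X1))
       ⊗ (((open_id (open_hunit X2) • open_id (open_hunit X2)) ⊗ open_id (open_hunit X3))
          • tensor_unit_cell X2 X3)
     • tensor_unit_cell X1 (cpS X2 X3))
    • open_cunit (cp_assoc cpS X1 X2 X3).
Proof.
apply: open_cell_eq; [by rewrite /= !cp_map1 | | by rewrite /= !cp_map1].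
by rewrite !oc_apex_vcomp; L_diagram.
Qed.

End AssociatorLaws.

Section Naturality.
Variables (X1 Y1 X2 Y2 X1' Y1' X2' Y2' : set_cat)
  (M1 : open_net X1 Y1) (M2 : open_net X2 Y2)
  (M1' : open_net X1' Y1') (M2' : open_net X2' Y2')
  (a1 : open_cell M1 M1') (a2 : open_cell M2 M2').

Lemma open_assoc_nat (X3 Y3 X3' Y3' : set_cat) (M3 : open_net X3 Y3)
    (M3' : open_net X3' Y3') (a3 : open_cell M3 M3') :
  open_assoc c M1' M2' M3' • ((a1 ⊗ a2) ⊗ a3)
  = (a1 ⊗ (a2 ⊗ a3)) • open_assoc c M1 M2 M3.
Proof.
by apply: open_cell_eq; [exact: (@cp_assoc_nat set_cat)
  | exact: (@cp_assoc_nat petri_cat) | exact: (@cp_assoc_nat set_cat)].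
Qed.

Lemma open_swap_nat :
  open_swap c M1' M2' • (a1 ⊗ a2) = (a2 ⊗ a1) • open_swap c M1 M2.
Proof.
by apply: open_cell_eq; [exact: (@cp_swap_nat set_cat)
  | exact: (@cp_swap_nat petri_cat) | exact: (@cp_swap_nat set_cat)].
Qed.

End Naturality.

Section SymmetryLaws.
Variables (X1 Y1 Z1 X2 Y2 Z2 : set_cat)
  (M1 : open_net Y1 Z1) (M2 : open_net Y2 Z2)
  (N1 : open_net X1 Y1) (N2 : open_net X2 Y2).

Lemma open_swap_comp (e : oc_src (open_swap c M1 M2) = oc_tgt (open_swap c N1 N2)) :
  open_swap c (M1 ⊙ N1) (M2 ⊙ N2) • tensor_comp M1 M2 N1 N2
  = ((open_id (M2 ⊙ N2) ⊗ open_id (M1 ⊙ N1)) • tensor_comp M2 M1 N2 N1)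
    • open_chcomp c e.
Proof.
apply: open_cell_eq; [by rewrite /= !cp_map1 | | by rewrite /= !cp_map1].
by rewrite !oc_apex_vcomp; apex_diagram.
Qed.

Lemma open_swap_unit :
  open_swap c (open_hunit X1) (open_hunit X2) • tensor_unit_cell X1 X2
  = ((open_id (open_hunit X2) ⊗ open_id (open_hunit X1)) • tensor_unit_cell X2 X1)
    • open_cunit (cp_swap cpS X1 X2).
Proof.
apply: open_cell_eq; [by rewrite /= !cp_map1 | | by rewrite /= !cp_map1].
by rewrite !oc_apex_vcomp; L_diagram.
Qed.

End SymmetryLaws.

Local Notation U := (open_hunit I).
Local Notation lunit M := (open_lunit (u := U) L_init M).
Local Notation runit M := (open_runit (u := U) L_init M).

Lemma open_lunit_nat (X Y X' Y' : set_cat) (M : open_net X Y) (M' : open_net X' Y')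
    (a : open_cell M M') : lunit M' • (open_id U ⊗ a) = a • lunit M.
Proof.
by apply: open_cell_eq; [exact: (@cp_lunit_nat set_cat)
  | exact: (@cp_lunit_nat petri_cat) | exact: (@cp_lunit_nat set_cat)].
Qed.

Lemma open_runit_nat (X Y X' Y' : set_cat) (M : open_net X Y) (M' : open_net X' Y')
    (a : open_cell M M') : runit M' • (a ⊗ open_id U) = a • runit M.
Proof.
by apply: open_cell_eq; [exact: (@cp_runit_nat set_cat)
  | exact: (@cp_runit_nat petri_cat) | exact: (@cp_runit_nat set_cat)].
Qed.

Lemma open_lunit_comp (X Y Z : set_cat) (M : open_net Y Z) (N : open_net X Y)
    (e : oc_src (lunit M) = oc_tgt (lunit N)) :
  lunit (M ⊙ N)
    • ((open_id U • open_hlunit c U) ⊗ open_id (M ⊙ N) • tensor_comp U M U N)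
  = open_id (M ⊙ N) • open_chcomp c e.
Proof.
apply: open_cell_eq; [by rewrite /= !cp_map1 | | by rewrite /= !cp_map1].
(* What the chase leaves is an equality of maps out of the initial net [LI]. *)
by rewrite !oc_apex_vcomp; apex_diagram; apply: init_L_hom.
Qed.

Lemma open_lunit_unit (X : set_cat) :
  lunit (open_hunit X)
    • ((open_id U • open_id U) ⊗ open_id (open_hunit X) • tensor_unit_cell I X)
  = open_id (open_hunit X) • open_cunit (cp_lunit cpS hI X).
Proof.
apply: open_cell_eq; [by rewrite /= !cp_map1 | | by rewrite /= !cp_map1].
by rewrite !oc_apex_vcomp; L_diagram; rewrite L_map1 composem1.
Qed.

Lemma open_runit_comp (X Y Z : set_cat) (M : open_net Y Z) (N : open_net X Y)
    (e : oc_src (runit M) = oc_tgt (runit N)) :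
  runit (M ⊙ N)
    • (open_id (M ⊙ N) ⊗ (open_id U • open_hlunit c U) • tensor_comp M U N U)
  = open_id (M ⊙ N) • open_chcomp c e.
Proof.
apply: open_cell_eq; [by rewrite /= !cp_map1 | | by rewrite /= !cp_map1].
by rewrite !oc_apex_vcomp; apex_diagram; apply: init_L_hom.
Qed.

Lemma open_runit_unit (X : set_cat) :
  runit (open_hunit X)
    • (open_id (open_hunit X) ⊗ (open_id U • open_id U) • tensor_unit_cell X I)
  = open_id (open_hunit X) • open_cunit (cp_runit cpS hI X).
Proof.
apply: open_cell_eq; [by rewrite /= !cp_map1 | | by rewrite /= !cp_map1].
by rewrite !oc_apex_vcomp; L_diagram; rewrite L_map1 composem1.
Qed.

(** * Associator, braiding and unitors as transformations of double functors *)

Local Notation T := open_tensorF.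
Local Notation UF := open_unitF.

(* As constants with the types expected by [DblTransf], these components can be
   composed with the comparisons of the composite functors without any conversion
   check that unfolds those functors. *)
Definition assoc_t0 (X : prod_dbl (prod_dbl D D) D) :
  hom (f0 (tensor3l T) X) (f0 (tensor3r T) X) := cp_assoc cpS X.1.1 X.1.2 X.2.

Definition assoc_t1 (X Y : prod_dbl (prod_dbl D D) D)
    (M : hor X Y) : cell (f1 (tensor3l T) M) (f1 (tensor3r T) M) :=
  open_assoc c M.1.1 M.1.2 M.2.

Definition swap_t0 (X : prod_dbl D D) :
  hom (f0 T X) (f0 (tensor_twist T) X) := cp_swap cpS X.1 X.2.

Definition swap_t1 (X Y : prod_dbl D D) (M : hor X Y) :
  cell (f1 T M) (f1 (tensor_twist T) M) := open_swap c M.1 M.2.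

Definition lunit_t0 (X : D) :
  hom (f0 (tensor_unitl T UF) X) (f0 (id_functor D) X) :=
  cp_lunit cpS hI X.

Definition lunit_t1 (X Y : D) (M : hor X Y) :
  cell (f1 (tensor_unitl T UF) M) (f1 (id_functor D) M) := lunit M.

Definition runit_t0 (X : D) :
  hom (f0 (tensor_unitr T UF) X) (f0 (id_functor D) X) :=
  cp_runit cpS hI X.

Definition runit_t1 (X Y : D) (M : hor X Y) :
  cell (f1 (tensor_unitr T UF) M) (f1 (id_functor D) M) := runit M.

(* To be used after splitting all objects and 1-cells into their components: with
   projections [M.1.1] left in the goal, the conversion check blows up. *)
Ltac unfold_functors := cbn [assoc_t0 assoc_t1 swap_t0 swap_t1 lunit_t0 lunit_t1
  runit_t0 runit_t1 tensor3l tensor3r tensor_unitl tensor_unitr tensor_twist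
  comp_functor pair_functor fst_functor snd_functor id_functor bang_functor
  open_tensorF open_unitF f0 f0m f1 f1m fcomp funit
  ccomp chcomp cid csrc ctgt cunit hunit open_dbl prod_dbl terminal_dbl dbl_base_of
  open_base prod_base terminal_base hcomp hor cell dbl0 fst snd].

Lemma assoc_t1_comp X Y Z (M : hor Y Z) (N : hor X Y) e :
  ccomp (assoc_t1 (hcomp M N)) (fcomp (tensor3l T) M N)
  = ccomp (fcomp (tensor3r T) M N) (chcomp (assoc_t1 M) (assoc_t1 N) e).
Proof.
move: X Y Z M N e => [[? ?] ?] [[? ?] ?] [[? ?] ?] [[? ?] ?] [[? ?] ?] e.
unfold_functors; simple apply open_assoc_comp.
Qed.

Lemma assoc_t1_unit (X : prod_dbl (prod_dbl D D) D) :
  ccomp (assoc_t1 (hunit X)) (funit (tensor3l T) X)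
  = ccomp (funit (tensor3r T) X) (cunit (@assoc_t0 X)).
Proof.
move: X => [[? ?] ?].
unfold_functors; simple apply open_assoc_unit.
Qed.

Definition open_assocT : dbl_transf (tensor3l T) (tensor3r T).
Proof.
refine (@DblTransf _ _ (tensor3l T) (tensor3r T) assoc_t0 _ assoc_t1 _ _ _
  assoc_t1_comp assoc_t1_unit).
- exact (fun X Y f => @cp_assoc_nat set_cat cpS _ _ _ _ _ _ f.1.1 f.1.2 f.2).
- exact (fun X Y X' Y' M M' a => open_assoc_nat a.1.1 a.1.2 a.2).
- by [].
- by [].
Defined.

Lemma swap_t1_comp X Y Z (M : hor Y Z) (N : hor X Y) e :
  ccomp (swap_t1 (hcomp M N)) (fcomp T M N)
  = ccomp (fcomp (tensor_twist T) M N) (chcomp (swap_t1 M) (swap_t1 N) e).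
Proof.
move: X Y Z M N e => [? ?] [? ?] [? ?] [? ?] [? ?] e.
unfold_functors; simple apply open_swap_comp.
Qed.

Lemma swap_t1_unit (X : prod_dbl D D) :
  ccomp (swap_t1 (hunit X)) (funit T X)
  = ccomp (funit (tensor_twist T) X) (cunit (@swap_t0 X)).
Proof.
move: X => [? ?].
unfold_functors; simple apply open_swap_unit.
Qed.

Definition open_braidT : dbl_transf T (tensor_twist T).
Proof.
refine (@DblTransf _ _ T (tensor_twist T) swap_t0 _ swap_t1 _ _ _
  swap_t1_comp swap_t1_unit).
- exact (fun X Y f => @cp_swap_nat set_cat cpS _ _ _ _ f.1 f.2).
- exact (fun X Y X' Y' M M' a => open_swap_nat a.1 a.2).
- by [].
- by [].
Defined.

Lemma lunit_t1_comp X Y Z (M : hor Y Z) (N : hor X Y) e :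
  ccomp (lunit_t1 (hcomp M N)) (fcomp (tensor_unitl T UF) M N)
  = ccomp (fcomp (id_functor D) M N) (chcomp (lunit_t1 M) (lunit_t1 N) e).
Proof.
unfold_functors; apply: open_lunit_comp.
Qed.

Lemma lunit_t1_unit (X : D) :
  ccomp (lunit_t1 (hunit X)) (funit (tensor_unitl T UF) X)
  = ccomp (funit (id_functor D) X) (cunit (@lunit_t0 X)).
Proof.
unfold_functors; apply: open_lunit_unit.
Qed.

Definition open_lunitT : dbl_transf (tensor_unitl T UF) (id_functor D).
Proof.
refine (@DblTransf _ _ (tensor_unitl T UF) (id_functor D)
  lunit_t0 _ lunit_t1 _ _ _ lunit_t1_comp lunit_t1_unit).
- exact (fun X Y f => @cp_lunit_nat set_cat cpS I hI _ _ f).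
- exact (fun X Y X' Y' M M' a => open_lunit_nat a).
- by [].
- by [].
Defined.

Lemma runit_t1_comp X Y Z (M : hor Y Z) (N : hor X Y) e :
  ccomp (runit_t1 (hcomp M N)) (fcomp (tensor_unitr T UF) M N)
  = ccomp (fcomp (id_functor D) M N) (chcomp (runit_t1 M) (runit_t1 N) e).
Proof.
unfold_functors; apply: open_runit_comp.
Qed.

Lemma runit_t1_unit (X : D) :
  ccomp (runit_t1 (hunit X)) (funit (tensor_unitr T UF) X)
  = ccomp (funit (id_functor D) X) (cunit (@runit_t0 X)).
Proof.
unfold_functors; apply: open_runit_unit.
Qed.

Definition open_runitT : dbl_transf (tensor_unitr T UF) (id_functor D).
Proof.
refine (@DblTransf _ _ (tensor_unitr T UF) (id_functor D)
  runit_t0 _ runit_t1 _ _ _ runit_t1_comp runit_t1_unit).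
- exact (fun X Y f => @cp_runit_nat set_cat cpS I hI _ _ f).
- exact (fun X Y X' Y' M M' a => open_runit_nat a).
- by [].
- by [].
Defined.

(** * Coherence axioms, invertibility of the constraints, and assembly *)

Lemma open_coherence0 :
  @sm_coherence D (tens0 open_tensorF) (@tens0m _ open_tensorF)
    (unit0 open_unitF) (assoc0 open_assocT) (lunit0 open_lunitT)
    (runit0 open_runitT) (braid0 open_braidT).
Proof. exact: (coproduct_coherence cpS hI). Qed.

(** Each axiom splits into the coproduct axiom in Set for source and target, and the one in Petri,
    with unit [LI], for the apex. *)
Lemma open_coherence1 :
  @sm_coherence (dbl1 D)
    (fun x y => hcell (tens1 open_tensorF (projT2 x) (projT2 y)))
    (fun x y x' y' alpha beta => tens1m open_tensorF alpha beta)
    (hcell (unit1 open_unitF))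
    (fun x y z => assoc1 open_assocT (projT2 x) (projT2 y) (projT2 z))
    (fun x => lunit1 open_lunitT (projT2 x))
    (fun x => runit1 open_runitT (projT2 x))
    (fun x y => braid1 open_braidT (projT2 x) (projT2 y)).
Proof.
have cS := coproduct_coherence cpS hI; have cP := coproduct_coherence cpP L_init.
split.
- move=> ? ? ? ?.
  by apply: open_cell_eq; [exact: (sm_pentagon cS) | exact: (sm_pentagon cP)
    | exact: (sm_pentagon cS)].
- move=> ? ?.
  by apply: open_cell_eq; [exact: (sm_triangle cS) | exact: (sm_triangle cP)
    | exact: (sm_triangle cS)].
- move=> ? ?.
  by apply: open_cell_eq; [exact: (sm_symmetry cS) | exact: (sm_symmetry cP)
    | exact: (sm_symmetry cS)].
- move=> ? ? ?.
  by apply: open_cell_eq; [exact: (sm_hexagon1 cS) | exact: (sm_hexagon1 cP)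
    | exact: (sm_hexagon1 cS)].
(* Projecting the two inverse equations for [v] makes each of its components an inverse of the
   corresponding coproduct associator. *)
- move=> ? ? ? v [h1 h2].
  apply: open_cell_eq.
  + exact: (sm_hexagon2 cS (conj (congr1 (@oc_src _ _ _ _ _ _) h1)
      (congr1 (@oc_src _ _ _ _ _ _) h2))).
  + exact: (sm_hexagon2 cP (conj (congr1 (@oc_apex _ _ _ _ _ _) h1)
      (congr1 (@oc_apex _ _ _ _ _ _) h2))).
  + exact: (sm_hexagon2 cS (conj (congr1 (@oc_tgt _ _ _ _ _ _) h1)
      (congr1 (@oc_tgt _ _ _ _ _ _) h2))).
Qed.

Lemma open_assoc_invertible (X1 Y1 X2 Y2 X3 Y3 : set_cat) (M1 : open_net X1 Y1)
    (M2 : open_net X2 Y2) (M3 : open_net X3 Y3) :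
  cinvertible (D := open_base c) (open_assoc c M1 M2 M3).
Proof. by apply: open_cell_invertible; apply: cp_assoc_invertible. Qed.

Lemma open_lunit_invertible (X Y : set_cat) (M : open_net X Y) :
  cinvertible (D := open_base c) (lunit M).
Proof. by apply: open_cell_invertible; apply: cp_lunit_invertible. Qed.

Lemma open_runit_invertible (X Y : set_cat) (M : open_net X Y) :
  cinvertible (D := open_base c) (runit M).
Proof. by apply: open_cell_invertible; apply: cp_runit_invertible. Qed.

Lemma open_swap_invertible (X1 Y1 X2 Y2 : set_cat) (M1 : open_net X1 Y1)
    (M2 : open_net X2 Y2) :
  cinvertible (D := open_base c) (open_swap c M1 M2).
Proof. by apply: open_cell_invertible; apply: cp_swap_invertible. Qed.

Lemma open_assocT_invertible : t_invertible open_assocT.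
Proof.
split=> [X|[[? ?] ?] [[? ?] ?] [[? ?] ?]].
- exact: (cp_assoc_invertible cpS X.1.1 X.1.2 X.2).
- exact: open_assoc_invertible.
Qed.

Definition open_petri : sym_mon_dbl_cat.
Proof.
refine (@SymMonDblCat D open_tensorF open_unitF erefl
  open_assocT open_assocT_invertible open_lunitT _ open_runitT _
  open_braidT _   open_coherence0 open_coherence1).
- exact: (conj (cp_lunit_invertible cpS hI) open_lunit_invertible).
- exact: (conj (cp_runit_invertible cpS hI) open_runit_invertible).
- exact: (conj (fun X => cp_swap_invertible cpS X.1 X.2)
    (fun X Y M => open_swap_invertible M.1 M.2)).
Defined.

End Monoidal.

Theorem theorem13 :
  inhabited colimit_choices /\
  forall c : colimit_choices,
  exists (D : sym_mon_dbl_cat) (u : open_net (set_init c) (set_init c))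
         (hu : initial (apex u)),
    sm_data_of D = open_petri_data c u hu.
Proof.
split; first exact: colimit_choices_exist.
(* The tensor unit is the horizontal unit on the initial set, with apex [LI]; the prescribed data
   then agree by conversion. *)
move=> c; exists (open_petri c), (open_hunit (set_init c)), (L_init c).
by [].
Qed.
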